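(* Let $k$ be a field. Then \[ c_1(k) = \begin{cases} 2 & \text{if } \operatorname{char}(k)=2,\\ 3 & \text{if } \operatorname{char}(k)\ge 3,\\ 3 & \text{if } \operatorname{char}(k)=0 \text{ and } -1 \text{ is a sum of two squares in } k,\\ 2 & \text{otherwise.} \end{cases} \]
   Context: For a field $k$ and a positive integer $n$, the Cremona group $\operatorname{Cr}_n(k)$ is the group of birational automorphisms of $\mathbb{P}^n_k$ over $k$; equivalently, the group of $k$-algebra automorphisms of the purely transcendental field extension $k(x_1,\ldots,x_n)/k$. For a finite group $G$, the representation dimension $\operatorname{rdim}_k(G)$ is the minimal $N$ such that there is an injective group homomorphism $G \hookrightarrow \operatorname{GL}_N(k)$. Define \[ c_n(k) := \sup\{\operatorname{rdim}_k(G) \mid G \text{ a finite group with } G \subseteq \operatorname{Cr}_n(k)\}. \] *)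

(* Defs.v *)
From HB Require Import structures.
From mathcomp Require Import all_boot all_order all_fingroup all_algebra.
From mathcomp Require Import mxrepresentation.
From mathcomp Require Import boolp classical_sets constructive_ereal.
(* The notations of mpoly and constructive_ereal clash. *)
From mathcomp Require Import -(notations) mpoly.

Set Implicit Arguments.
Unset Strict Implicit.
Unset Printing Implicit Defensive.

Import GRing.Theory.
Local Open Scope ring_scope.

(* k(x_1, ..., x_n) *)
Definition ratfun (n : nat) (k : fieldType) : fieldType :=
  {fraction (mpoly n k)}.

Definition ratfunC (n : nat) (k : fieldType) (c : k) : ratfun n k :=
  FracField.tofrac (mpolyC n c).

Definition is_kalg_aut (n : nat) (k : fieldType) (f : ratfun n k -> ratfun n k)
    : Prop :=
  [/\ GRing.zmod_morphism f, GRing.monoid_morphism f,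
      forall c : k, f (ratfunC n c) = ratfunC n c & bijective f].

(* The group law is composition. The predicate is wrapped in asbool so that the
   type is a subType of ratfun n k -> ratfun n k, and hence extensional. *)
Record cremona (n : nat) (k : fieldType) := Cremona {
  cremona_fun : ratfun n k -> ratfun n k;
  cremona_funP : `[< is_kalg_aut cremona_fun >]
}.

Section CremonaGroup.
Variables (n : nat) (k : fieldType).
Local Notation K := (ratfun n k).

HB.instance Definition _ := [isSub for @cremona_fun n k].
HB.instance Definition _ := [Choice of cremona n k by <:].

Lemma kalg_aut_id : is_kalg_aut (@id K).
Proof. by split=> //; exists id. Qed.

Lemma kalg_aut_comp (f g : K -> K) :
  is_kalg_aut f -> is_kalg_aut g -> is_kalg_aut (f \o g).
Proof.
move=> [fB [f1 fM] fC fb] [gB [g1 gM] gC gb]; split.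
- by move=> x y /=; rewrite gB fB.
- by split=> [|x y] /=; rewrite ?g1 // gM fM.
- by move=> c /=; rewrite gC fC.
- exact: bij_comp.
Qed.

Lemma kalg_aut_can (f g : K -> K) :
  cancel f g -> cancel g f -> is_kalg_aut f -> is_kalg_aut g.
Proof.
move=> fK gK [fB [f1 fM] fC _]; have fI := can_inj fK; split.
- by move=> x y; apply: fI; rewrite fB !gK.
- by split=> [|x y]; apply: fI; rewrite ?fM !gK.
- by move=> c; apply: fI; rewrite fC gK.
- by exists f.
Qed.

Definition cremona1 : cremona n k := Cremona (asboolT kalg_aut_id).

Definition cremonaM (f g : cremona n k) : cremona n k :=
  Cremona (asboolT (kalg_aut_comp (asboolW (cremona_funP f))
                                  (asboolW (cremona_funP g)))).

Lemma cremona_inv_subproof (f : cremona n k) :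
  exists g : cremona n k, cancel (cremona_fun f) (cremona_fun g)
                       /\ cancel (cremona_fun g) (cremona_fun f).
Proof.
have fA := asboolW (cremona_funP f); have [_ _ _ [g fK gK]] := fA.
by exists (Cremona (asboolT (kalg_aut_can fK gK fA))).
Qed.

Definition cremonaV (f : cremona n k) : cremona n k :=
  projT1 (cid (cremona_inv_subproof f)).

Lemma cremonaA : associative cremonaM.
Proof. by move=> f g h; apply: val_inj. Qed.

Lemma cremona1M : left_id cremona1 cremonaM.
Proof. by move=> f; apply: val_inj. Qed.

Lemma cremonaM1 : right_id cremona1 cremonaM.
Proof. by move=> f; apply: val_inj. Qed.

Lemma cremonaVM : left_inverse cremona1 cremonaV cremonaM.
Proof.
move=> f; apply/val_inj/funext => x /=.
by rewrite /cremonaV; case: cid => g [/= + _]; apply.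
Qed.

Lemma cremonaMV : right_inverse cremona1 cremonaV cremonaM.
Proof.
move=> f; apply/val_inj/funext => x /=.
by rewrite /cremonaV; case: cid => g [/= _]; apply.
Qed.

HB.instance Definition _ := isGroup.Build (cremona n k)
  cremonaA cremona1M cremonaM1 cremonaVM cremonaMV.

End CremonaGroup.

Section RepresentationDimension.
Variables (k : fieldType) (gT : finGroupType) (G : {group gT}).

(* A faithful mx_representation of G in degree N is an injective homomorphism
   from G to the invertible N x N matrices. *)
Definition has_faithful_repr (N : nat) : Prop :=
  exists rG : mx_representation k G N, mx_faithful rG.

Lemma has_faithful_repr_ex : exists N, `[< has_faithful_repr N >].
Proof.
exists #|G|; apply/asboolP.
by exists (regular_repr k G); apply: regular_mx_faithful.
Qed.

Definition rdim : nat := ex_minn has_faithful_repr_ex.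

End RepresentationDimension.

Local Open Scope classical_set_scope.

Definition cremona_rdims (n : nat) (k : fieldType) : set (\bar int) :=
  [set d | exists gT : finGroupType,
     (exists f : {multiplicative gT -> cremona n k}, injective f)
     /\ d = ((rdim k [set: gT])%:Z)%:E].

(* The supremum is taken in the extended integers, so that it always exists
   and is +oo when the representation dimensions are unbounded. *)
Definition cremona_c (n : nat) (k : fieldType) : \bar int :=
  supremum -oo%E (cremona_rdims n k).

(* Main.v *)
From HB Require Import structures.
Require Import Defs.
From mathcomp Require Import all_boot all_order all_algebra.
From mathcomp Require Import boolp constructive_ereal.
From mathcomp Require Import all_fingroup all_solvable mxrepresentation.
From mathcomp Require Import polyXY ring zify.
From mathcomp Require Import -(notations) mpoly.

(* An automorphism of k(x) over k is a Moebius transformation: if x is sent to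
   u = p/q in lowest terms and x = r(u)/s(u), then p(T) - Y q(T) divides
   s(Y) T - r(Y), which has degree 1 in T.  So a finite subgroup G of Cr_1(k)
   has a projective representation g |-> A_g by invertible 2 x 2 matrices, in
   which only the identity is sent to a scalar matrix.

   Upper bounds: the action on binary quadratic forms divided by the
   determinant is faithful of degree 3, and in characteristic 2 so is the
   degree 2 representation "square the entries, divide by the determinant".
   In characteristic 0, suppose that -1 is not a sum of two squares.  Then two
   commuting elements of the normal subgroup H of those g for which det A_g is
   a square have commuting lifts, as anticommuting ones would generate a split
   quaternion algebra (-1, -1).  So centralizers of nontrivial elements of H
   are abelian, and a count of the conjugates of these centralizers shows that
   one of them is normal in H.  Hence G normalizes a torus, and sending a to
   a/a' on the torus, with a' the conjugate of a, linearizes G in degree 2.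

   Lower bounds: Cr_1(k) contains the noncommutative group S_3.  If k does not
   have characteristic 2 and -1 is a sum of two squares, the Hurwitz
   quaternions yield A_4 in Cr_1(k), and in a representation of A_4 of degree 2
   an involution has determinant 1, hence is scalar, hence is not faithful. *)

Set Implicit Arguments.
Unset Strict Implicit.
Unset Printing Implicit Defensive.
Import GRing.Theory.

(** * Groups partitioned by centralizers *)

Section CentralizerPartition.
Local Open Scope group_scope.
Variables (gT : finGroupType) (H : {group gT}).
Hypothesis cent1_abelian : {in H^#, forall x, abelian 'C_H[x]}.
Hypothesis norm_cent1_involution :
  {in H^# & H, forall x y, y \in 'N('C_H[x]) -> y \notin 'C_H[x] -> y ^+ 2 = 1}.

(** The centralizer of [b] is abelian and contains [a], so all its elements commute with [a]; the
    roles are symmetric. Hence commuting is an equivalence relation on [H^#], whose classes are the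
    sets ['C_H[x]^#]. *)
Lemma cent1_eq x y : x \in H^# -> y \in H^# -> y \in 'C_H[x] ->
  'C_H[y] = 'C_H[x].
Proof.
suff sub a b : a \in H^# -> b \in H^# -> b \in 'C[a] -> 'C_H[b] \subset 'C_H[a].
  move=> Hx Hy /setIP[_ Cxy]; apply/eqP; rewrite eqEsubset !sub //.
  by rewrite cent1C.
move=> /setD1P[_ Ha] Hb Cab; apply/subsetP => z Cbz.
have [Hz _] := setIP Cbz; rewrite inE Hz /=.
have Cba : a \in 'C_H[b] by rewrite inE Ha cent1C.
by apply/cent1P; apply: (centsP (cent1_abelian Hb)).
Qed.

Lemma conj_cent1 x y : y \in H -> 'C_H[x] :^ y = 'C_H[x ^ y].
Proof. by move=> Hy; rewrite conjIg conjGid // cent1J. Qed.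

Lemma cent1_id x : x \in H -> x \in 'C_H[x].
Proof. by move=> Hx; rewrite inE Hx cent1id. Qed.

Lemma cent1D1_sub x : 'C_H[x]^# \subset H^#.
Proof. by rewrite setSD ?subsetIl. Qed.

Lemma conj_inD1 x y : x \in H^# -> y \in H -> x ^ y \in H^#.
Proof. by move=> /setD1P[ntx Hx] Hy; rewrite in_setD1 conjg_eq1 ntx groupJ. Qed.

(** A nontrivial [a] in ['C_H[x]] determines this centralizer, as it equals ['C_H[a]]. So if [a ^ g]
    lies in it too, [g] normalizes it. Distinct conjugates thus meet trivially, and the size of
    their union can be read off. *)
Lemma normedTI_cent1 x : x \in H^# -> normedTI 'C_H[x]^# H 'N_H('C_H[x]).
Proof.
move=> Hx; apply/normedTI_memJ_P; split=> [||a g Ca Hg].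
- apply/set0Pn; exists x; have [ntx Hx1] := setD1P Hx.
  by rewrite in_setD1 ntx cent1_id.
- exact: subsetIl.
have Ha := subsetP (cent1D1_sub x) a Ca; have [nt_a Ha1] := setD1P Ha.
have [_ Ca1] := setD1P Ca.
rewrite (in_setI g) Hg /= in_setD1 conjg_eq1 nt_a /=.
have -> : (g \in 'N('C_H[x])) = ('C_H[a ^ g] == 'C_H[a]).
  rewrite -conj_cent1 // (cent1_eq Hx Ha Ca1).
  by apply/normP/eqP.
apply/idP/eqP=> [Cag|Eag].
  by rewrite (@cent1_eq x (a ^ g)) ?(@cent1_eq x a) ?conj_inD1.
by rewrite -(cent1_eq Hx Ha Ca1) -Eag cent1_id ?groupJ.
Qed.

Let S x := class_support 'C_H[x]^# H.

Lemma card_class_support_cent1 x : x \in H^# ->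
  #|S x| = (#|'C_H[x]|.-1 * #|H : 'N_H('C_H[x])|)%N.
Proof.
move=> Hx; rewrite (card_support_normedTI (normedTI_cent1 Hx)).
by rewrite (cardsD1 1 'C_H[x]) group1.
Qed.

Lemma class_support_cent1_sub x : S x \subset H^#.
Proof.
apply/subsetP => _ /imset2P[a g Ca Hg ->].
by apply: conj_inD1 => //; apply: (subsetP (cent1D1_sub x)).
Qed.

(** A common element would make ['C_H[y]] share a nontrivial element with a conjugate of ['C_H[x]].
    The two would then be equal, which puts [y] in [S x]. *)
Lemma disjoint_class_support_cent1 x y : x \in H^# -> y \in H^# ->
  y \notin S x -> [disjoint S x & S y].
Proof.
move=> Hx Hy; apply: contraR => /pred0Pn[z /andP[]].
case/imset2P=> a g Ca Hg -> /imset2P[b h Cb Hh Eab].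
have Ha := subsetP (cent1D1_sub x) a Ca.
have Hb := subsetP (cent1D1_sub y) b Cb.
have [[_ Ca1] [_ Cb1]] := (setD1P Ca, setD1P Cb).
have Eb : b = a ^ (g * h^-1) by rewrite conjgM Eab conjgK.
have Hgh : g * h^-1 \in H by rewrite groupM ?groupV.
have [nty Hy1] := setD1P Hy.
have Cya : y \in 'C_H[x] :^ (g * h^-1).
  rewrite -(cent1_eq Hx Ha Ca1) conj_cent1 // -Eb (cent1_eq Hy Hb Cb1).
  exact: cent1_id.
rewrite -(conjgKV (g * h^-1) y); apply: memJ_class_support => //.
by rewrite in_setD1 conjg_eq1 nty -mem_conjg.
Qed.

(** An element [z] of [N] outside [C] is an involution, and so is [c * z] for [c] in [C]; hence [z]
    inverts [C]. A quotient of two such elements fixes [x], which gives index 2. An involution of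
    [C] would be fixed by [z], so its centralizer, which is [C], would contain [z]. *)
Lemma cent1_norm_cases x : x \in H^# ->
  'N_H('C_H[x]) = 'C_H[x] \/
  [/\ #|'N_H('C_H[x])| = (2 * #|'C_H[x]|)%N, odd #|'C_H[x]|
    & exists2 y, y \in H^# & y ^+ 2 = 1].
Proof.
move=> Hx; have [_ Hx1] := setD1P Hx; set C := 'C_H[x]; set N := 'N_H(C).
have sCN : C \subset N by rewrite subsetI subsetIl normG.
have [sNC|/subsetPn[y Ny nCy]] := boolP (N \subset C).
  by left; apply/eqP; rewrite eqEsubset sNC sCN.
right.
have invK z : z \in N -> z \notin C -> z^-1 = z.
  case/setIP=> Hz Nz nCz; apply: (mulgI z); rewrite mulgV.
  by rewrite -(norm_cent1_involution Hx Hz Nz nCz).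
have invC z c : z \in N -> z \notin C -> c \in C -> c ^ z = c^-1.
  move=> Nz nCz Cc; have Nc := subsetP sCN c Cc.
  have nCcz : c * z \notin C by rewrite groupMl.
  have E : c * z = z * c^-1.
    by rewrite -[LHS](invK _ (groupM Nc Nz) nCcz) invMg (invK z).
  by rewrite conjgE E mulKg.
have Hy : y \in H^#.
  rewrite in_setD1; case/setIP: Ny => -> _; rewrite andbT.
  by apply: contraNneq nCy => ->; apply: group1.
split; last by exists y => //; rewrite expgS expg1 -{1}(invK y) ?mulVg.
  rewrite -(cardsID C) (setIidPr sCN) mulSn mul1n; congr (_ + _)%N.
  rewrite -(card_rcoset C y); apply: eq_card => z; rewrite mem_rcoset in_setD.
  apply/andP/idP => [[nCz Nz]|Czy].
    have [[Hz _] [Hy1 _]] := (setIP Nz, setIP Ny).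
    rewrite in_setI groupM ?groupV //=; apply/cent1P/commute_sym/commgP/conjg_fixP.
    by rewrite invK // conjgM (invC z) ?cent1_id // conjVg (invC y) ?cent1_id ?invgK.
  have Nz : z \in N by rewrite -(mulgKV y z) groupM // (subsetP sCN).
  split=> //; apply: contra nCy => Cz.
  by rewrite -groupV -(mulKg z y^-1) groupM ?groupV.
apply: contraT; rewrite -dvdn2 => /(@Cauchy _ 2 _ isT)[u Cu ou]; case/negP: (nCy).
have [Hu1 _] := setIP Cu.
have Hu : u \in H^# by rewrite in_setD1 -order_eq1 ou Hu1.
have [Hy1 _] := setIP Ny.
rewrite /C -(cent1_eq Hx Hu Cu) in_setI Hy1; apply/cent1P/commute_sym/commgP.
apply/conjg_fixP; rewrite (invC _ _ Ny nCy Cu); apply: (mulgI u).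
by rewrite mulgV -[RHS]expg2 -ou expg_order.
Qed.

(* The sets [S x] partition [H^#].  If no centralizer were normal, a set [S x]
   with ['C_H[x]] self-normalizing would have at least [#|H| / 2] elements and
   any other one at least [#|H| / 3], which leaves no room for a consistent
   count. *)
Lemma cent1_normal_exists : H :!=: 1 -> exists2 x, x \in H^# & 'C_H[x] <| H.
Proof.
move=> ntH; apply: contrapT => no_normal.
have H_gt0 := cardG_gt0 H.
(* If the centralizer of [x] is not self-normalizing, its normalizer supplies an involution [y]. As
   [y] lies in ['C_H[y]], this group has even order, so only the first case is left for [y]. *)
have [x0 Hx0 N0] : exists2 x, x \in H^# & 'N_H('C_H[x]) = 'C_H[x].
  have [x Hx] : exists x, x \in H^# by apply/set0Pn; rewrite setD_eq0 subG1.
  have [|[_ _ [y Hy y2]]] := cent1_norm_cases Hx; first by exists x.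
  exists y => //; have [//|[_ oddC _]] := cent1_norm_cases Hy.
  have [nty Hy1] := setD1P Hy; case/negP: nty.
  have co2C : coprime 2 #|'C_H[y]| by rewrite coprime2n.
  by rewrite -order_eq1 -dvdn1 -(eqP co2C) dvdn_gcd order_dvdn y2 eqxx
    order_dvdG ?cent1_id.
have gt1 x : x \in H^# -> (1 < #|'C_H[x]|)%N /\ (1 < #|H : 'N_H('C_H[x])|)%N.
  move=> Hx; have [ntx Hx1] := setD1P Hx; split.
    rewrite cardG_gt1; apply: contraNneq ntx => C1.
    by apply/eqP/set1gP; rewrite -C1 cent1_id.
  rewrite indexg_gt1; apply/negP => sHN; apply: no_normal; exists x => //.
  by rewrite /normal subsetIl (subset_trans sHN) ?subsetIr.
have cases x : x \in H^# -> exists m r,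
    [/\ (1 < m)%N, (1 < r)%N, #|S x| = (m.-1 * r)%N &
      #|H| = (m * r)%N \/ (2 < m)%N /\ #|H| = (2 * (m * r))%N].
  move=> Hx; have [C_gt1 r_gt1] := gt1 x Hx.
  exists #|'C_H[x]|, #|H : 'N_H('C_H[x])|.
  split; rewrite ?card_class_support_cent1 //.
  have := Lagrange (subsetIl H 'N('C_H[x])).
  have [E1|[-> oddC _]] := cent1_norm_cases Hx.
    by move=> <-; left; rewrite /= {1}E1.
  rewrite -mulnA => <-; right; split=> //.
  by move: C_gt1 oddC; case: #|_| => [|[|[|]]].
have ex_notin (A : {set gT}) : (#|A| < #|H|.-1)%N ->
    exists2 x, x \in H^# & x \notin A.
  move=> ltA; suff /subsetPn[x] : ~~ (H^# \subset A) by exists x.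
  apply: contraL ltA => /subset_leq_card; rewrite -leqNgt.
  by rewrite (cardsD1 1 H) group1.
have subD1 (A : {set gT}) : A \subset H^# -> (#|A| <= #|H|.-1)%N.
  by move=> /subset_leq_card; rewrite (cardsD1 1 H) group1.
have [m0 [r0 [m0_gt1 r0_gt1 cS0 cH0]]] : exists m r,
    [/\ (1 < m)%N, (1 < r)%N, #|S x0| = (m.-1 * r)%N & #|H| = (m * r)%N].
  have [C_gt1 r_gt1] := gt1 x0 Hx0; have := card_class_support_cent1 Hx0.
  exists #|'C_H[x0]|, #|H : 'N_H('C_H[x0])|; split=> //.
  by rewrite -{1}N0 Lagrange ?subsetIl.
have [x1 Hx1 nS1] : exists2 x, x \in H^# & x \notin S x0.
  by apply: ex_notin; rewrite cS0 cH0; nia.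
have [m1 [r1 [m1_gt1 r1_gt1 cS1 cH1]]] := cases x1 Hx1.
have dis01 := disjoint_class_support_cent1 Hx0 Hx1 nS1.
have card01 : #|S x0 :|: S x1| = (#|S x0| + #|S x1|)%N.
  by rewrite cardsU disjoint_setI0 // cards0 subn0.
have le01 : (#|S x0| + #|S x1| <= #|H|.-1)%N.
  by rewrite -card01; apply: subD1; rewrite subUset !class_support_cent1_sub.
case: cH1 => [cH1|[m1_gt2 cH1]].
  by move: le01; rewrite cS0 cS1; nia.
(* [S x1] has at least a third of [#|H|] elements, which forces [1 - 1 / m0 < 2 / 3]. *)
have m0E : m0 = 2 by move: le01; rewrite cS0 cS1; nia.
(* The two supports miss exactly [r1 - 1] elements of [H^#]. A third support then brings the total
   to at least [1/2 + 1/3 + 1/3] of [#|H|]. *)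
have [x2 Hx2] : exists2 x, x \in H^# & x \notin S x0 :|: S x1.
  by apply: ex_notin; rewrite card01 cS0 cS1; nia.
rewrite in_setU negb_or => /andP[nS02 nS12].
have [m2 [r2 [m2_gt1 r2_gt1 cS2 cH2]]] := cases x2 Hx2.
have dis02 := disjoint_class_support_cent1 Hx0 Hx2 nS02.
have dis12 := disjoint_class_support_cent1 Hx1 Hx2 nS12.
have : (#|S x0| + #|S x1| + #|S x2| <= #|H|.-1)%N.
  have dis : [disjoint S x0 :|: S x1 & S x2].
    by rewrite -setI_eq0 setIUl !disjoint_setI0 ?setU0.
  rewrite -card01 -[leqLHS]subn0 -(cards0 gT) -(disjoint_setI0 dis) -cardsU.
  by apply: subD1; rewrite !subUset !class_support_cent1_sub.
rewrite cS0 cS1 cS2; case: cH2 => [cH2|[m2_gt2 cH2]]; nia.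
Qed.

(* Two normal centralizers meeting trivially would commute with each other. *)
Lemma conj_normal_cent1 x y : x \in H^# -> y \in 'N(H) -> 'C_H[x] <| H ->
  x ^ y \in 'C_H[x].
Proof.
move=> Hx Ny /andP[_ nC]; have [ntx Hx1] := setD1P Hx.
have Hxy : x ^ y \in H by rewrite memJ_norm.
have Hxy' : x ^ y \in H^# by rewrite in_setD1 conjg_eq1 ntx.
have CJ : 'C_H[x ^ y] = 'C_H[x] :^ y by rewrite conjIg cent1J (normP Ny).
have nCJ : H \subset 'N('C_H[x ^ y]) by rewrite CJ normJ -{1}(normP Ny) conjSg.
have [tiC|/trivgPn[z /setIP[Cz CJz] ntz]] := eqVneq ('C_H[x] :&: 'C_H[x ^ y]) 1.
  rewrite in_setI Hxy; apply/cent1P/commute_sym/commgP; rewrite -in_set1.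
  have <- : [1 gT] = [set 1] by [].
  rewrite -tiC in_setI; apply/andP; split.
    rewrite commgEl groupM ?groupV ?cent1_id // memJ_norm ?cent1_id //.
    exact: (subsetP nC).
  rewrite commgEr groupM ?cent1_id // memJ_norm ?groupV ?cent1_id //.
  exact: (subsetP nCJ).
have Hz : z \in H^# by rewrite in_setD1 ntz; case/setIP: Cz.
by rewrite -(cent1_eq Hx Hz Cz) (cent1_eq Hxy' Hz CJz) cent1_id.
Qed.

End CentralizerPartition.

(** * Two by two matrices *)

Section Mx2.
Local Open Scope ring_scope.
Variable k : fieldType.
Implicit Types (a b c d x y : k) (M N : 'M[k]_2).

Definition mx2 a b c d : 'M[k]_2 :=
  \matrix_(i, j) nth 0 (nth [::] [:: [:: a; b]; [:: c; d]] i) j.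

Lemma mx2_inj a b c d a' b' c' d' : mx2 a b c d = mx2 a' b' c' d' ->
  [/\ a = a', b = b', c = c' & d = d'].
Proof.
move/matrixP=> E; split.
- by have := E 0 0; rewrite !mxE.
- by have := E 0 1; rewrite !mxE.
- by have := E 1 0; rewrite !mxE.
- by have := E 1 1; rewrite !mxE.
Qed.

Lemma mx2P M : exists a b c d, M = mx2 a b c d.
Proof.
exists (M 0 0), (M 0 1), (M 1 0), (M 1 1); apply/matrixP => i j; rewrite mxE.
by case: i j => [[|[|//]] i] [[|[|//]] j] /=; congr (M _ _); apply: val_inj.
Qed.

Lemma mx2M a b c d a' b' c' d' : mx2 a b c d *m mx2 a' b' c' d' =
  mx2 (a * a' + b * c') (a * b' + b * d') (c * a' + d * c') (c * b' + d * d').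
Proof.
apply/matrixP => i j; rewrite !mxE !big_ord_recl big_ord0 !mxE addr0.
by case: i j => [[|[|//]] i] [[|[|//]] j].
Qed.

Lemma mx2Z x a b c d : x *: mx2 a b c d = mx2 (x * a) (x * b) (x * c) (x * d).
Proof.
apply/matrixP => i j; rewrite !mxE.
by case: i j => [[|[|//]] i] [[|[|//]] j].
Qed.

Lemma mx2D a b c d a' b' c' d' : mx2 a b c d + mx2 a' b' c' d' =
  mx2 (a + a') (b + b') (c + c') (d + d').
Proof.
apply/matrixP => i j; rewrite !mxE.
by case: i j => [[|[|//]] i] [[|[|//]] j].
Qed.

Lemma mx2_scalar x : x%:M = mx2 x 0 0 x.
Proof.
apply/matrixP => i j; rewrite !mxE.
by case: i j => [[|[|//]] i] [[|[|//]] j].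
Qed.

Lemma det_mx2 a b c d : \det (mx2 a b c d) = a * d - b * c.
Proof.
rewrite (expand_det_row _ 0) !big_ord_recl big_ord0 /cofactor !det_mx11 !mxE /=.
by rewrite /bump /= ?addn0 ?add0n; ring.
Qed.

Lemma tr_mx2 a b c d : \tr (mx2 a b c d) = a + d.
Proof. by rewrite /mxtrace !big_ord_recl big_ord0 !mxE addr0. Qed.

Lemma mx2N a b c d : - mx2 a b c d = mx2 (- a) (- b) (- c) (- d).
Proof. by rewrite -scaleN1r mx2Z !mulN1r. Qed.

Definition mx2E := (mx2M, mx2Z, mx2D, mx2N, mx2_scalar).

Lemma eq_of_sub x y a b : a = b -> x - y = a - b -> x = y.
Proof. by move=> -> /eqP; rewrite subrr subr_eq0 => /eqP. Qed.

Lemma is_scalar_mx2 a b c d :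
  is_scalar_mx (mx2 a b c d) = [&& b == 0, c == 0 & a == d].
Proof.
apply/is_scalar_mxP/and3P=> [[x]|[/eqP-> /eqP-> /eqP->]].
  by rewrite mx2_scalar => /mx2_inj[-> -> -> ->].
by exists d; rewrite mx2_scalar.
Qed.

(** A nonscalar matrix of size 2 is cyclic, so only polynomials in it commute with it, and these
    reduce to degree at most 1. The coefficients are found by dividing by a nonzero entry among [b],
    [c] and [a - d]. *)
Lemma mx2_comm_span M N : ~~ is_scalar_mx M -> M *m N = N *m M ->
  exists x y, N = x%:M + y *: M.
Proof.
have [a [b [c [d ->]]]] := mx2P M; have [p [q [r [s ->]]]] := mx2P N.
rewrite is_scalar_mx2 => nsc; rewrite !mx2E => /mx2_inj[E1 E2 E3 E4].
have F1 : b * r = q * c by apply: (eq_of_sub E1); ring.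
have F2 : q * (a - d) = b * (p - s) by apply: (eq_of_sub E2); ring.
have F3 : r * (a - d) = c * (p - s) by apply: (eq_of_sub (esym E3)); ring.
have [b0|nb] := eqVneq b 0; last first.
  exists (p - q / b * a), (q / b); rewrite !mx2E; congr mx2; try by field.
    by apply: (mulfI nb); rewrite F1; field.
  by apply: (mulfI nb); apply: (eq_of_sub F2); field.
have [c0|nc] := eqVneq c 0; last first.
  exists (p - r / c * a), (r / c); rewrite !mx2E; congr mx2; try by field.
    by apply: (mulfI nc); rewrite mulrC -F1; field.
  by apply: (mulfI nc); apply: (eq_of_sub F3); field.
have nad : a - d != 0 by move: nsc; rewrite b0 c0 !eqxx /= subr_eq0.
exists (p - (p - s) / (a - d) * a), ((p - s) / (a - d)).
rewrite !mx2E b0 c0; congr mx2; try by field.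
  by apply: (mulIf nad); rewrite F2 b0; ring.
by apply: (mulIf nad); rewrite F3 c0; ring.
Qed.

Lemma mx2_cent_comm M N N' : ~~ is_scalar_mx M -> M *m N = N *m M ->
  M *m N' = N' *m M -> N *m N' = N' *m N.
Proof.
move=> nsM /(mx2_comm_span nsM)[x [y ->]] cN'.
by rewrite mulmxDl mulmxDr -scalemxAl -scalemxAr cN' scalar_mxC.
Qed.

Lemma mx2_anticomm_trace M N : (2%:R : k) != 0 -> \det N != 0 ->
  M *m N = - (N *m M) -> \tr M = 0.
Proof.
move=> two_neq0 dN E; have uN : N \in unitmx by rewrite unitmxE unitfE.
have E' : \tr M = - \tr M.
  by rewrite -{1}(mulmxK uN M) E mulNmx raddfN /= mxtrace_mulC mulmxA mulVmx ?mul1mx.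
have: \tr M * 2%:R = 0 by rewrite mulr_natr mulr2n {1}E' addNr.
by move/eqP; rewrite mulf_eq0 (negPf two_neq0) orbF => /eqP.
Qed.

Lemma mx2_sqr_traceless M : \tr M = 0 -> M *m M = (- \det M)%:M.
Proof.
have [a [b [c [d ->]]]] := mx2P M; rewrite tr_mx2 => /eqP.
rewrite addr_eq0 => /eqP ->; rewrite det_mx2 !mx2E.
by congr mx2; ring.
Qed.

(* The two matrices generate a quaternion algebra, which is therefore split. *)
Lemma anticomm_sum2sqr M N s t : (2%:R : k) != 0 ->
  \det M = s ^+ 2 -> \det N = t ^+ 2 -> s != 0 -> t != 0 ->
  M *m N = - (N *m M) -> exists a b : k, -1 = a ^+ 2 + b ^+ 2.
Proof.
move=> two_neq0 dM dN s0 t0 E.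
have trM : \tr M = 0 by apply: (mx2_anticomm_trace two_neq0 _ E); rewrite dN expf_neq0.
have trN : \tr N = 0.
  apply: (@mx2_anticomm_trace _ M two_neq0); first by rewrite dM expf_neq0.
  by rewrite E opprK.
move: dM dN trM trN E.
have [p [q [r [p' ->]]]] := mx2P M; have [u [v [w [u' ->]]]] := mx2P N.
rewrite !tr_mx2 !det_mx2 => dM dN /eqP; rewrite addrC addr_eq0 => /eqP p'E.
move/eqP; rewrite addrC addr_eq0 => /eqP u'E; subst p' u'.
rewrite !mx2E => /mx2_inj[E _ _ _].
have [r0|nr] := eqVneq r 0.
  exists (p / s), 0; apply: (mulIf (expf_neq0 2 s0)); rewrite mulN1r -[in LHS]dM r0.
  by field.
(* The matrix [N - (w / r) *: M] is traceless and upper triangular with first entry [u - p * w / r].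
   Anticommuting [M] and [N] are orthogonal for the determinant form, so its determinant is also
   [t ^+ 2 + (w / r * s) ^+ 2]. Dividing by [t ^+ 2] gives the witnesses. *)
exists (u / t - p * w / (r * t)), (s * w / (r * t)).
apply: (mulIf (expf_neq0 2 t0)); rewrite mulN1r -[in LHS]dN.
apply: (mulIf (expf_neq0 2 nr)).
transitivity ((u * r - p * w) ^+ 2 + s ^+ 2 * w ^+ 2); last by field; rewrite ?nr ?t0.
by apply: (eq_of_sub (congr1 (fun z => r * w * z) E)); rewrite -dM; ring.
Qed.
End Mx2.

(** * Projective representations of degree 2 *)

Section ProjectiveRepresentation.
Local Open Scope ring_scope.
Variables (k : fieldType) (gT : finGroupType).

(** Chosen lifts to matrices of an injective homomorphism from [gT] to [PGL_2(k)]. *)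
Definition proj_faithful (A : gT -> 'M[k]_2) : Prop :=
  [/\ forall g, \det (A g) != 0,
      forall g h, exists c, A g *m A h = c *: A (g * h)%g
    & forall g, is_scalar_mx (A g) -> g = 1%g].

Variable A : gT -> 'M[k]_2.
Hypothesis projA : proj_faithful A.

Let detA g : \det (A g) != 0. Proof. by case: projA. Qed.
Let unitA g : A g \in unitmx. Proof. by rewrite unitmxE unitfE. Qed.

Lemma projM g h : exists2 c, c != 0 & A g *m A h = c *: A (g * h)%g.
Proof.
have [_ /(_ g h)[c Ec] _] := projA; exists c => //.
apply: contraTneq (detA g) => c0; move/(congr1 determinant): Ec.
rewrite c0 scale0r det_mulmx det0 // => /eqP.
by rewrite mulf_eq0 (negPf (detA h)) orbF => /eqP ->; rewrite eqxx.
Qed.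

Lemma projI g : is_scalar_mx (A g) -> g = 1%g.
Proof. by case: projA => _ _; apply. Qed.

Lemma proj1_scalar : is_scalar_mx (A 1%g).
Proof.
have [c _] := projM 1 1; rewrite mulg1 => E; apply/is_scalar_mxP; exists c.
by rewrite -[A 1%g](mulmxK (unitA 1%g)) E -scalemxAl mulmxV ?scalemx1.
Qed.

Lemma proj_inj g h c : A g = c *: A h -> g = h.
Proof.
move=> E; have [c' _] := projM (g * h^-1)%g h.
rewrite mulgKV E scalerA => E'; apply/eqP; rewrite eq_mulgV1; apply/eqP/projI.
apply/is_scalar_mxP; exists (c' * c).
by rewrite -[A _](mulmxK (unitA h)) E' -scalemxAl mulmxV ?scalemx1.
Qed.

Lemma projX g n : exists c, A g ^+ n = c *: A (g ^+ n)%g.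
Proof.
elim: n => [|n [c IH]].
  have /is_scalar_mxP[x E] := proj1_scalar; exists x^-1.
  have x0 : x != 0 by apply: contraNneq (detA 1%g) => x0; rewrite E x0 det_scalar expr0n.
  by rewrite expr0 expg0 E -[x%:M]scalemx1 scalerA mulVf // scale1r.
have [c' _ E] := projM g (g ^+ n)%g; exists (c * c').
by rewrite exprS expgS IH -[_ * _]/(_ *m _) -scalemxAr E scalerA.
Qed.

(** Being invariant under scaling, [R] does not see the factors of the projective representation, so
    [R \o A] is an honest one. *)
Lemma faithful_of_proj N (R : 'M[k]_2 -> 'M[k]_N) :
    (forall c g, c != 0 -> R (c *: A g) = R (A g)) ->
    (forall g h, R (A g) *m R (A h) = R (A g *m A h)) ->
    R (A 1%g) = 1%:M -> (forall g, R (A g) = 1%:M -> is_scalar_mx (A g)) ->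
  has_faithful_repr k [set: gT]%G N.
Proof.
move=> RZ RM R1 RI.
have reprR : mx_repr [set: gT] (R \o A).
  split=> [|g h _ _] //=.
  by have [c c0 E] := projM g h; rewrite RM E RZ.
exists (MxRepresentation reprR); apply/subsetP => g.
rewrite !inE /= mul1mx => /eqP E.
by apply/eqP/projI/RI.
Qed.

(** Entrywise squaring is multiplicative because the Frobenius is additive, and scaling by [c]
    contributes [c ^+ 2] both to the squares and to the determinant. A matrix in the kernel is
    diagonal with [p ^+ 2 = s ^+ 2], whence [p = s]. *)
Lemma faithful_of_proj_char2 : 2%N \in [pchar k] ->
  has_faithful_repr k [set: gT]%G 2.
Proof.
move=> ch2; have two0 : (2%:R : k) = 0 by apply: pcharf0.
pose R (M : 'M[k]_2) := (\det M)^-1 *: map_mx (fun x => x ^+ 2) M.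
have RE a b c d : R (mx2 a b c d) =
    (a * d - b * c)^-1 *: mx2 (a ^+ 2) (b ^+ 2) (c ^+ 2) (d ^+ 2).
  rewrite /R det_mx2; congr (_ *: _); apply/matrixP => i j; rewrite !mxE.
  by case: i j => [[|[|//]] i] [[|[|//]] j].
have RZ c g : c != 0 -> R (c *: A g) = R (A g).
  have := detA g; have [p [q [r [s ->]]]] := mx2P (A g).
  rewrite mx2Z !RE !mx2Z det_mx2 => d c0.
  have -> : (c * p * (c * s) - c * q * (c * r)) = c ^+ 2 * (p * s - q * r) by ring.
  by congr mx2; field; rewrite c0 d.
apply: (@faithful_of_proj _ R) => [c g c0|g h||g]; first exact: RZ.
- have := detA h; have := detA g.
  have [p [q [r [s ->]]]] := mx2P (A g).
  have [p' [q' [r' [s' ->]]]] := mx2P (A h); rewrite !det_mx2 => d1 d2.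
  have dbl (x y : k) : (x + y) ^+ 2 = x ^+ 2 + y ^+ 2.
    by rewrite sqrrD -mulr_natr two0 mulr0 addr0.
  rewrite mx2M !RE !mx2Z mx2M !dbl.
  have -> : (p * p' + q * r') * (r * q' + s * s') - (p * q' + q * s') * (r * p' + s * r')
    = (p * s - q * r) * (p' * s' - q' * r') by ring.
  by congr mx2; field; rewrite d1 d2.
- have /is_scalar_mxP[x E] := proj1_scalar; have := detA 1%g.
  rewrite E mx2_scalar RE det_mx2 mx2Z => d; rewrite mx2_scalar.
  have x0 : x != 0 by apply: contraNneq d => ->; rewrite !mul0r subr0.
  by congr mx2; field; rewrite ?x0.
have := detA g; have [p [q [r [s ->]]]] := mx2P (A g); rewrite RE mx2Z det_mx2 => d.
rewrite mx2_scalar is_scalar_mx2 => /mx2_inj[E1 /eqP E2 /eqP E3 E4].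
move: E2 E3; rewrite !mulf_eq0 invr_eq0 (negPf d) !orbb /= => -> ->.
have E : p ^+ 2 = s ^+ 2 by apply: (mulfI (invr_neq0 d)); rewrite E1 E4.
have : (p - s) ^+ 2 = 0.
  by rewrite sqrrB E -mulr_natr two0 mulr0 subr0 -mulr2n -mulr_natr two0 mulr0.
by move/eqP; rewrite mulf_eq0 orbb subr_eq0.
Qed.

Definition mx3 (r : seq (seq k)) : 'M[k]_3 := \matrix_(i, j) nth 0 (nth [::] r i) j.

(* The action on binary quadratic forms, twisted by the inverse determinant. *)
Lemma faithful_of_proj_sym2 : has_faithful_repr k [set: gT]%G 3.
Proof.
pose R (M : 'M[k]_2) := let a := M 0 0 in let b := M 0 1 in
  let c := M 1 0 in let d := M 1 1 in
  (\det M)^-1 *: mx3 [:: [:: a ^+ 2; a * b; b ^+ 2];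
    [:: 2%:R * a * c; a * d + b * c; 2%:R * b * d]; [:: c ^+ 2; c * d; d ^+ 2]].
have RE a b c d : R (mx2 a b c d) = (a * d - b * c)^-1 *:
   mx3 [:: [:: a ^+ 2; a * b; b ^+ 2];
    [:: 2%:R * a * c; a * d + b * c; 2%:R * b * d]; [:: c ^+ 2; c * d; d ^+ 2]].
  by rewrite /R det_mx2 !mxE.
apply: (@faithful_of_proj _ R) => [c g c0|g h||g].
- have := detA g; have [p [q [r [s ->]]]] := mx2P (A g).
  rewrite mx2Z !RE det_mx2 => d.
  have -> : (c * p * (c * s) - c * q * (c * r)) = c ^+ 2 * (p * s - q * r) by ring.
  apply/matrixP => i j; rewrite !mxE.
  by case: i j => [[|[|[|//]]] i] [[|[|[|//]]] j] /=; field; rewrite c0 d.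
- have := detA h; have := detA g.
  have [p [q [r [s ->]]]] := mx2P (A g).
  have [p' [q' [r' [s' ->]]]] := mx2P (A h); rewrite !det_mx2 => d1 d2.
  rewrite mx2M !RE.
  have -> : (p * p' + q * r') * (r * q' + s * s') - (p * q' + q * s') * (r * p' + s * r')
    = (p * s - q * r) * (p' * s' - q' * r') by ring.
  rewrite -scalemxAl -scalemxAr scalerA -invfM; congr (_ *: _).
  apply/matrixP => i j; rewrite !mxE !big_ord_recl big_ord0 !mxE.
  by case: i j => [[|[|[|//]]] i] [[|[|[|//]]] j] /=; ring.
- have /is_scalar_mxP[x E] := proj1_scalar; have := detA 1%g.
  rewrite E mx2_scalar RE det_mx2 => d.
  have x0 : x != 0 by apply: contraNneq d => ->; rewrite !mul0r subr0.
  apply/matrixP => i j; rewrite !mxE.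
  by case: i j => [[|[|[|//]]] i] [[|[|[|//]]] j] /=; field; rewrite ?x0.
have := detA g; have [p [q [r [s ->]]]] := mx2P (A g); rewrite RE det_mx2 => d E.
(* The off-diagonal corners give [q = r = 0]; the first two diagonal entries then give
   [p ^+ 2 = p * s]. No division by 2 occurs, so this is valid in every characteristic. *)
have Eij i j := congr1 (fun M : 'M_3 => M i j) E.
have := Eij 0 ord_max; have := Eij ord_max 0; have := Eij 0 0; have := Eij 1 1.
rewrite !mxE /= => E11 E00 /eqP E20 /eqP E02; move: E20 E02.
rewrite is_scalar_mx2 !mulf_eq0 invr_eq0 (negPf d) !orbb /= => r0 q0.
rewrite q0 r0 /=; move: E11 E00; rewrite (eqP r0) mulr0 addr0 => E11 E00.
have p0 : p != 0 by apply: contraNneq d => ->; rewrite (eqP r0) mul0r mulr0 subr0.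
apply/eqP/(mulfI p0); apply: (mulfI (invr_neq0 d)); rewrite -expr2.
by move: E11 E00; rewrite (eqP r0) mulr0 => -> ->.
Qed.

End ProjectiveRepresentation.

(** * Linearization of a projective group that preserves an axis *)

Section Axis.
Local Open Scope ring_scope.
Variables (k : fieldType) (gT : finGroupType).
Hypothesis two_neq0 : (2%:R : k) != 0.

(* With [a = x + y sqrt(alpha)], the matrices commuting with the companion
   matrix of [X^2 - alpha] are the multiplications by [a], those anticommuting
   with it are [a] times conjugation.  The representation maps [a] to [a / a']
   where [a'] is the conjugate of [a], and conjugation to itself. *)
Lemma faithful_of_proj_companion (A : gT -> 'M[k]_2) (alpha : k) :
    proj_faithful A -> alpha != 0 ->
    (forall g, A g *m mx2 0 alpha 1 0 = mx2 0 alpha 1 0 *m A g \/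
               A g *m mx2 0 alpha 1 0 = - (mx2 0 alpha 1 0 *m A g)) ->
  has_faithful_repr k [set: gT]%G 2.
Proof.
move=> projA alpha0 comA; have [detA _ _] := projA.
(* The first column of [M] is [a = x + y sqrt(alpha)]. The quotient [a / a'] is [a ^+ 2] divided by
   the norm of [a], which explains the entries; the sign [e] composes with conjugation off the
   torus. *)
pose R (M : 'M[k]_2) := let x := M 0 0 in let y := M 1 0 in
  let e := if M *m mx2 0 alpha 1 0 == mx2 0 alpha 1 0 *m M then 1 else -1 in
  (x ^+ 2 - alpha * y ^+ 2)^-1 *: mx2 (x ^+ 2 + alpha * y ^+ 2)
    (e * (2%:R * alpha * x * y)) (2%:R * x * y) (e * (x ^+ 2 + alpha * y ^+ 2)).
have Rcom (x y : k) : R (mx2 x (alpha * y) y x) = (x ^+ 2 - alpha * y ^+ 2)^-1 *: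
    mx2 (x ^+ 2 + alpha * y ^+ 2) (2%:R * alpha * x * y)
        (2%:R * x * y) (x ^+ 2 + alpha * y ^+ 2).
  rewrite /R !mxE /= ifT ?mul1r // !mx2M; apply/eqP.
  by congr mx2; ring.
have Ranti (x y : k) : x ^+ 2 - alpha * y ^+ 2 != 0 ->
    R (mx2 x (- (alpha * y)) y (- x)) = (x ^+ 2 - alpha * y ^+ 2)^-1 *:
    mx2 (x ^+ 2 + alpha * y ^+ 2) (- (2%:R * alpha * x * y))
        (2%:R * x * y) (- (x ^+ 2 + alpha * y ^+ 2)).
  move=> d; rewrite /R !mxE /= ifF ?mulN1r // !mx2M; apply/negP => /eqP/mx2_inj[E1 E2 _ _].
  have twice0 (z : k) : z = - z -> z = 0.
    move=> E; have : z * 2%:R = 0 by rewrite mulr_natr mulr2n {1}E addNr.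
    by move/eqP; rewrite mulf_eq0 (negPf two_neq0) orbF => /eqP.
  have ay0 : alpha * y = 0 by apply/twice0/esym; apply: (eq_of_sub E1); ring.
  have ax0 : alpha * x = 0 by apply/twice0/esym; apply: (eq_of_sub (esym E2)); ring.
  move/eqP: ay0; move/eqP: ax0; rewrite !mulf_eq0 (negPf alpha0) /= => /eqP x0 /eqP y0.
  by move: d; rewrite x0 y0 !expr0n mulr0 subr0 eqxx.
have shape g : exists x y, x ^+ 2 - alpha * y ^+ 2 != 0 /\
   (A g = mx2 x (alpha * y) y x \/ A g = mx2 x (- (alpha * y)) y (- x)).
  have := comA g; have := detA g; have [p [q [r [s ->]]]] := mx2P (A g).
  rewrite det_mx2 !mx2E => d [/mx2_inj[E1 E2 E3 E4]|/mx2_inj[E1 E2 E3 E4]]; exists p, r.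
    have Eq : q = alpha * r by apply: (eq_of_sub E1); ring.
    have Es : s = p by apply: (eq_of_sub E3); ring.
    split; last by left; rewrite Eq Es.
    by move: d; rewrite Eq Es; apply: contraNneq => E; apply/eqP; rewrite -[RHS]E; ring.
  have Eq : q = - (alpha * r) by apply: (eq_of_sub E1); ring.
  have Es : s = - p by apply: (eq_of_sub E3); ring.
  split; last by right; rewrite Eq Es.
  by move: d; rewrite Eq Es; apply: contraNneq => E; apply/eqP; rewrite -oppr0 -E; ring.
have dM x y x' y' : x ^+ 2 - alpha * y ^+ 2 != 0 -> x' ^+ 2 - alpha * y' ^+ 2 != 0 ->
    (x * x' + alpha * y * y') ^+ 2 - alpha * (x * y' + y * x') ^+ 2 != 0.
  move=> d d'; have -> : (x * x' + alpha * y * y') ^+ 2 - alpha * (x * y' + y * x') ^+ 2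
    = (x ^+ 2 - alpha * y ^+ 2) * (x' ^+ 2 - alpha * y' ^+ 2) by ring.
  by rewrite mulf_neq0.
(* The norm of [a] times the conjugate of a second element, the product that occurs when the first
   factor involves conjugation. *)
have dM' x y x' y' : x ^+ 2 - alpha * y ^+ 2 != 0 -> x' ^+ 2 - alpha * y' ^+ 2 != 0 ->
    (x * x' - alpha * y * y') ^+ 2 - alpha * (- (x * y') + y * x') ^+ 2 != 0.
  move=> d d'; have := @dM x y x' (- y') d; rewrite sqrrN => /(_ d').
  by rewrite !mulrN.
apply: (faithful_of_proj projA (R := R)) => [c g c0|g h||g].
- have [x [y [d]]] := shape g; case=> ->; rewrite mx2Z.
  + have -> : mx2 (c * x) (c * (alpha * y)) (c * y) (c * x) =
       mx2 (c * x) (alpha * (c * y)) (c * y) (c * x) by congr mx2; ring.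
    by rewrite !Rcom !mx2Z; congr mx2; field; rewrite d;
      rewrite -[X in X != 0](_ : c ^+ 2 * (x ^+ 2 - alpha * y ^+ 2) = _);
      rewrite ?mulf_neq0 ?expf_neq0 //; ring.
  have -> : mx2 (c * x) (c * - (alpha * y)) (c * y) (c * - x) =
       mx2 (c * x) (- (alpha * (c * y))) (c * y) (- (c * x)) by congr mx2; ring.
  have d' : (c * x) ^+ 2 - alpha * (c * y) ^+ 2 != 0.
    have -> : (c * x) ^+ 2 - alpha * (c * y) ^+ 2 = c ^+ 2 * (x ^+ 2 - alpha * y ^+ 2) by ring.
    by rewrite mulf_neq0 ?expf_neq0.
  by rewrite !Ranti // !mx2Z; congr mx2; field; rewrite d d'.
- have [x [y [d Eg]]] := shape g; have [x' [y' [d' Eh]]] := shape h.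
  have dd := dM _ _ _ _ d d'; have dd' := dM' _ _ _ _ d d'.
  case: Eg => ->; case: Eh => ->; rewrite mx2M.
  + rewrite [in RHS](_ : mx2 _ _ _ _ =
        mx2 (x * x' + alpha * y * y') (alpha * (x * y' + y * x'))
       (x * y' + y * x') (x * x' + alpha * y * y')); last by congr mx2; ring.
    by rewrite !Rcom !mx2Z mx2M; congr mx2; field; rewrite d d' dd.
  + rewrite [in RHS](_ : mx2 _ _ _ _ =
        mx2 (x * x' + alpha * y * y') (- (alpha * (x * y' + y * x')))
       (x * y' + y * x') (- (x * x' + alpha * y * y'))); last by congr mx2; ring.
    by rewrite Rcom !Ranti // !mx2Z mx2M; congr mx2; field; rewrite d d' dd.
  + rewrite [in RHS](_ : mx2 _ _ _ _ =
        mx2 (x * x' - alpha * y * y') (- (alpha * (- (x * y') + y * x')))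
       (- (x * y') + y * x') (- (x * x' - alpha * y * y'))); last by congr mx2; ring.
    by rewrite Rcom !Ranti // !mx2Z mx2M; congr mx2; field; rewrite d d' dd'.
  rewrite [in RHS](_ : mx2 _ _ _ _ =
        mx2 (x * x' - alpha * y * y') (alpha * (- (x * y') + y * x'))
       (- (x * y') + y * x') (x * x' - alpha * y * y')); last by congr mx2; ring.
  by rewrite Rcom !Ranti // !mx2Z mx2M; congr mx2; field; rewrite d d' dd'.
- have /is_scalar_mxP[x E] := proj1_scalar projA; have := detA 1%g.
  rewrite E mx2_scalar det_mx2 => d.
  have x0 : x != 0 by apply: contraNneq d => ->; rewrite !mul0r subr0.
  have := Rcom x 0; rewrite mulr0 => ->; rewrite mx2Z mx2_scalar.
  by congr mx2; field; rewrite ?x0.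
(* On the torus, [a = a'] forces [y = 0]. Off the torus the diagonal entries of the image are
   opposite, so they cannot both be 1. *)
have [x [y [d]]] := shape g; case=> ->.
  rewrite Rcom mx2Z mx2_scalar is_scalar_mx2 eqxx andbT => /mx2_inj[E _ _ _].
  have : x ^+ 2 + alpha * y ^+ 2 = x ^+ 2 - alpha * y ^+ 2.
    by apply: (mulfI (invr_neq0 d)); rewrite E mulVf.
  move/addrI/eqP; rewrite -addr_eq0 -mulr2n -mulr_natr !mulf_eq0 (negPf two_neq0).
  by rewrite (negPf alpha0) orbF orbb /= => ->.
rewrite Ranti // mx2Z mx2_scalar => /mx2_inj[E1 _ _ E4].
case/eqP: two_neq0; transitivity (1 + 1 : k) => //.
by rewrite -{1}E1 -E4; ring.
Qed.

(** A traceless invertible [X] squares to the scalar [- \det X] and is not scalar, so it becomes a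
    companion matrix in a basis [v], [X v]. These are the columns of [Q], with [v] the first basis
    vector, the second one or their sum. *)
Lemma faithful_of_proj_axis (A : gT -> 'M[k]_2) X :
    proj_faithful A -> \tr X = 0 -> \det X != 0 ->
    (forall g, A g *m X = X *m A g \/ A g *m X = - (X *m A g)) ->
  has_faithful_repr k [set: gT]%G 2.
Proof.
move=> projA trX detX comA; have [detA mulA scalA] := projA.
have [Q uQ EQ] : exists2 Q, Q \in unitmx & X *m Q = Q *m mx2 0 (- \det X) 1 0.
  move: trX detX; have [p [q [r [s ->]]]] := mx2P X; rewrite tr_mx2 det_mx2 => /eqP.
  rewrite addrC addr_eq0 => /eqP ->; rewrite mulrN opprB opprK => d.
  have [r0|r0] := eqVneq r 0; last first.
    exists (mx2 1 p 0 r); first by rewrite unitmxE unitfE det_mx2 mul1r mulr0 subr0.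
    by rewrite !mx2M; congr mx2; ring.
  have [q0|q0] := eqVneq q 0; last first.
    exists (mx2 0 q 1 (- p)).
      by rewrite unitmxE unitfE det_mx2 mul0r mulr1 sub0r oppr_eq0.
    by rewrite !mx2M; congr mx2; ring.
  have p0 : p != 0 by apply: contraNneq d => ->; rewrite r0; apply/eqP; ring.
  exists (mx2 1 p 1 (- p)).
    rewrite unitmxE unitfE det_mx2 mul1r mulr1 -opprD -mulr2n -mulr_natr.
    by rewrite oppr_eq0 mulf_neq0.
  by rewrite !mx2M r0 q0; congr mx2; ring.
pose B g := invmx Q *m A g *m Q.
have BM g h : B g *m B h = invmx Q *m (A g *m A h) *m Q.
  by rewrite /B !mulmxA mulmxK.
have projB : proj_faithful B.
  split=> [g|g h|g].
  - rewrite !det_mulmx mulrAC det_inv mulVf ?mul1r //.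
    by rewrite -unitfE -unitmxE.
  - have [c E] := mulA g h; exists c.
    by rewrite BM E -scalemxAr -scalemxAl.
  case/is_scalar_mxP=> x E; apply: scalA; apply/is_scalar_mxP; exists x.
  have : Q *m B g *m invmx Q = A g by rewrite /B !mulmxA mulmxV // mul1mx mulmxK.
  by move<-; rewrite E scalar_mxC -mulmxA mulmxV // mulmx1.
apply: (faithful_of_proj_companion (A := B) (alpha := - \det X)) => // [|g].
  by rewrite oppr_eq0.
have CE : mx2 0 (- \det X) 1 0 = invmx Q *m X *m Q by rewrite -mulmxA EQ mulKmx.
have conjM (M N : 'M[k]_2) :
    (invmx Q *m M *m Q) *m (invmx Q *m N *m Q) = invmx Q *m (M *m N) *m Q.
  by rewrite !mulmxA mulmxK.
rewrite CE !conjM; case: (comA g) => ->; [by left|right].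
by rewrite mulmxN mulNmx.
Qed.
End Axis.

(** * Projective groups in characteristic 0 when -1 is not a sum of two squares *)

Section CharacteristicZero.
Local Open Scope ring_scope.
Variables (k : fieldType) (gT : finGroupType).
Hypothesis char0 : [pchar k] =i pred0.
Hypothesis no_sum2sqr : ~ exists a b : k, -1 = a ^+ 2 + b ^+ 2.

Let natr_neq0 n : (0 < n)%N -> (n%:R : k) != 0.
Proof. by rewrite (pcharf0P _).1 // -lt0n. Qed.

Let two_neq0 : (2%:R : k) != 0. Proof. exact: natr_neq0. Qed.

Definition traceless (M : 'M[k]_2) := M - (\tr M / 2%:R)%:M.

Lemma tr_traceless M : \tr (traceless M) = 0.
Proof. by rewrite raddfB /= mxtrace_scalar -[_ *+ 2]mulr_natr divfK ?subrr. Qed.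

Lemma traceless_add M : (\tr M / 2%:R)%:M + traceless M = M.
Proof. by rewrite addrC subrK. Qed.

Lemma is_scalar_traceless M : is_scalar_mx (traceless M) -> is_scalar_mx M.
Proof.
case/is_scalar_mxP=> x E; rewrite -(traceless_add M) E; apply/is_scalar_mxP.
by exists (\tr M / 2%:R + x); rewrite raddfD.
Qed.

Lemma traceless_affine x y M : traceless (x%:M + y *: M) = y *: traceless M.
Proof.
rewrite /traceless raddfD /= mxtrace_scalar mxtraceZ scalerBr.
have -> : (x *+ 2 + y * \tr M) / 2%:R = x + y * (\tr M / 2%:R).
  by rewrite -mulr_natr; field.
by rewrite raddfD /= scale_scalar_mx opprD addrACA subrr add0r.
Qed.

(** Conjugation by [P] sends [M] into the algebra generated by [M], so it multiplies the traceless
    part of [M] by a scalar. Comparing determinants, the square of this scalar is 1. *)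
Lemma conj_traceless M N P c : ~~ is_scalar_mx M -> \det (traceless M) != 0 ->
    \det P != 0 -> M *m N = N *m M -> P *m M = c *: (N *m P) ->
  P *m traceless M = traceless M *m P \/
  P *m traceless M = - (traceless M *m P).
Proof.
move=> nsM dX dP /(mx2_comm_span nsM)[x [y NE]].
have uP : P \in unitmx by rewrite unitmxE unitfE.
move=> /(congr1 (fun M => M *m invmx P)).
rewrite -scalemxAl mulmxK // NE scalerDr scalerA scale_scalar_mx.
move=> /(congr1 traceless); rewrite traceless_affine => E.
have {}E : P *m traceless M = (c * y) *: (traceless M *m P).
  rewrite scalemxAl -E /traceless mxtrace_mulC mulKmx // mulmxBl mulmxKV //.
  by rewrite mulmxBr scalar_mxC.
have := congr1 determinant E; rewrite detZ !det_mulmx [X in _ = _ * X]mulrC.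
rewrite -[LHS]mul1r => /(mulIf (mulf_neq0 dP dX))/esym/eqP.
by rewrite sqrf_eq1 E => /orP[/eqP->|/eqP->]; rewrite ?scale1r ?scaleN1r; [left|right].
Qed.

(** If the traceless part [X] were singular, [X ^+ 2] would vanish and [M ^+ n] would be [t ^+ n]
    plus [n * t ^+ n.-1] times [X]. In characteristic 0 this coefficient is nonzero, so [X] would be
    scalar. *)
Lemma traceless_finite_order M n x : (0 < n)%N -> \det M != 0 ->
  ~~ is_scalar_mx M -> M ^+ n = x%:M -> \det (traceless M) != 0.
Proof.
move=> n0 dM nsM Mn; apply: contra nsM => /eqP d0.
set t := \tr M / 2%:R; set X := traceless M in d0 *.
have X2 : X * X = 0.
  by rewrite -[LHS]/(X *m X) mx2_sqr_traceless ?tr_traceless // d0 oppr0 raddf0.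
have ME : M = t%:M + X by rewrite traceless_add.
(* At [m = 0] the exponent [m.-1] takes its default value 0, harmlessly, as the term is taken 0
   times. *)
have pow m : M ^+ m = (t ^+ m)%:M + (t ^+ m.-1 *+ m) *: X.
  elim: m => [|m IH]; first by rewrite expr0 mulr0n scale0r addr0.
  rewrite exprS IH ME mulrDl !mulrDr.
  rewrite -![X * (_ *: _)]scalerAr X2 scaler0 addr0.
  rewrite -[t%:M * _]/(t%:M *m _) -[t%:M * _]/(t%:M *m _) -[X * _]/(X *m _).
  rewrite -scalar_mxM -exprS !mul_scalar_mx mul_mx_scalar scalerA -addrA -scalerDl.
  congr (_ + _ *: _); case: m {IH} => [|m]; first by rewrite mulr0n mulr0 add0r expr0.
  by rewrite mulrnAr -exprS /= [RHS]mulrSr.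
have t0 : t != 0.
  by apply: contraNneq dM => t0; rewrite ME t0 raddf0 add0r d0.
apply: is_scalar_traceless; apply/is_scalar_mxP; rewrite -/X.
have tn0 : t ^+ n.-1 *+ n != 0.
  by rewrite -mulr_natr mulf_neq0 ?expf_neq0 ?natr_neq0.
exists ((t ^+ n.-1 *+ n)^-1 * (x - t ^+ n)).
rewrite -scale_scalar_mx raddfB /= -Mn pow addrAC subrr add0r scalerA.
by rewrite mulVf ?scale1r.
Qed.

Variable A : gT -> 'M[k]_2.
Hypothesis projA : proj_faithful A.

Let detA g : \det (A g) != 0. Proof. by case: projA. Qed.

Lemma proj_nonscalar g : g != 1%g -> ~~ is_scalar_mx (A g).
Proof. by apply: contraNN => /(projI projA) ->. Qed.

Lemma det_traceless_proj g : g != 1%g -> \det (traceless (A g)) != 0.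
Proof.
move=> ntg; have [c] := projX projA g #[g]%g; rewrite expg_order => E.
have /is_scalar_mxP[x E1] := proj1_scalar projA.
move: E; rewrite E1 scale_scalar_mx.
by apply: traceless_finite_order; rewrite ?order_gt0 ?proj_nonscalar.
Qed.

Lemma proj_swap g h : exists2 c, c != 0 &
  A h *m A g = c *: (A (g ^ h^-1)%g *m A h).
Proof.
have [c c0 E] := projM projA h g; have [c' c'0 E'] := projM projA (g ^ h^-1)%g h.
exists (c / c'); first by rewrite mulf_neq0 ?invr_neq0.
by rewrite E E' scalerA divfK // conjgE invgK mulgA mulgKV.
Qed.

Lemma axis_conj g h : g != 1%g -> A g *m A (g ^ h^-1)%g = A (g ^ h^-1)%g *m A g ->
  A h *m traceless (A g) = traceless (A g) *m A h \/
  A h *m traceless (A g) = - (traceless (A g) *m A h).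
Proof.
move=> ntg com; have [c c0 E] := proj_swap g h.
by apply: (conj_traceless (c := c) _ _ _ com E);
  rewrite ?proj_nonscalar ?det_traceless_proj.
Qed.

(** The determinant of a lift is well defined modulo squares and multiplicative there; this is the
    kernel of the resulting homomorphism. *)
Definition det_square g := `[< exists t, \det (A g) = t ^+ 2 >].

Lemma det_squareP g : reflect (exists t, \det (A g) = t ^+ 2) (det_square g).
Proof. exact: asboolP. Qed.

Lemma det_squareM g h :
  reflect (exists t, \det (A g) * \det (A h) = t ^+ 2) (det_square (g * h)%g).
Proof.
have ex_c : exists2 c, c != 0 & \det (A g) * \det (A h) = c ^+ 2 * \det (A (g * h)%g).
  by have [c c0 E] := projM projA g h; exists c => //; rewrite -det_mulmx E detZ.
apply: (iffP (det_squareP _)) => -[t Et]; have [c c0 E] := ex_c.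
  by exists (c * t); rewrite E Et exprMn.
exists (t / c); apply: (mulfI (expf_neq0 2 c0)); rewrite -E Et.
by field.
Qed.

Lemma det_proj_conj g h : exists c, \det (A (g ^ h)%g) = c ^+ 2 * \det (A g).
Proof.
have [c c0 /(congr1 determinant)] := proj_swap g h^-1%g.
rewrite invgK detZ !det_mulmx => E; exists c^-1.
apply: (mulfI (expf_neq0 2 c0)); apply: (mulIf (detA h^-1%g)).
by rewrite -[LHS]mulrA -E exprVn mulVKf ?expf_neq0 // mulrC.
Qed.

Lemma det_square_group_set : group_set [set g | det_square g].
Proof.
apply/group_setP; split=> [|g h]; rewrite !inE.
  have /is_scalar_mxP[x E] := proj1_scalar projA.
  by apply/det_squareP; exists x; rewrite E det_scalar.
move=> /det_squareP[s Es] /det_squareP[t Et]; apply/det_squareM.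
by exists (s * t); rewrite Es Et exprMn.
Qed.

Canonical det_square_group := Group det_square_group_set.
Local Notation H := det_square_group.

Lemma det_square_conj g h : g \in H -> (g ^ h)%g \in H.
Proof.
rewrite !inE => /det_squareP[t Et]; have [c E] := det_proj_conj g h.
by apply/det_squareP; exists (c * t); rewrite E Et exprMn.
Qed.

(* Otherwise the lifts anticommute, and [-1] is a sum of two squares. *)
Lemma det_square_commute g h : g \in H -> h \in H -> commute g h ->
  A g *m A h = A h *m A g.
Proof.
rewrite !inE => /det_squareP[s Es] /det_squareP[t Et] com.
have [c c0 E] := projM projA g h; have [c' c'0 E'] := projM projA h g.
have {}E : A g *m A h = (c / c') *: (A h *m A g).
  by rewrite E E' scalerA divfK // com.
have := congr1 determinant E; rewrite detZ !det_mulmx [X in _ = _ * X]mulrC.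
rewrite -[LHS]mul1r => /(mulIf (mulf_neq0 (detA g) (detA h)))/esym/eqP.
rewrite sqrf_eq1 => /orP[/eqP ec|/eqP ec]; first by rewrite E ec scale1r.
case: no_sum2sqr; apply: (@anticomm_sum2sqr _ (A g) (A h) s t) => //.
- by apply: contraNneq (detA g) => s0; rewrite Es s0 expr0n.
- by apply: contraNneq (detA h) => t0; rewrite Et t0 expr0n.
by rewrite E ec scaleN1r.
Qed.

Lemma proj_commute g h : A g *m A h = A h *m A g -> commute g h.
Proof.
have [c c0 ->] := projM projA g h; have [c' c'0 ->] := projM projA h g.
move=> /(congr1 (fun M => c^-1 *: M)); rewrite !scalerA mulVf // scale1r.
exact: (proj_inj projA).
Qed.

Lemma proj_sqr_traceless g : \tr (A g) = 0 -> (g ^+ 2)%g = 1%g.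
Proof.
move=> tr0; apply: (projI projA); rewrite expgS expg1; have [c c0] := projM projA g g.
rewrite mx2_sqr_traceless // => /(congr1 (fun M => c^-1 *: M)).
rewrite scalerA mulVf // scale1r scale_scalar_mx => <-.
exact: scalar_mx_is_scalar.
Qed.

(** The lifts of elements of ['C_H[x]] commute with the nonscalar matrix [A x], hence with each
    other. *)
Lemma det_square_cent1_abelian : {in H^#, forall x, abelian 'C_H[x]}%g.
Proof.
move=> x /setD1P[ntx Hx]; apply/centsP => a /setIP[Ha /cent1P ca] b /setIP[Hb /cent1P cb].
apply: proj_commute; apply: (mx2_cent_comm (proj_nonscalar ntx)).
  by apply: det_square_commute => //; apply: commute_sym.
by apply: det_square_commute => //; apply: commute_sym.
Qed.

(** As [x] commutes with its conjugate under [y^-1], the matrix [A y] commutes or anticommutes with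
    the traceless part of [A x]. Commuting would put [y] in the centralizer; anticommuting makes
    [A y] traceless, so its square is scalar. *)
Lemma det_square_norm_cent1 :
  {in H^# & H, forall x y, y \in 'N('C_H[x]) -> y \notin 'C_H[x] -> y ^+ 2 = 1}%g.
Proof.
move=> x y /setD1P[ntx Hx] Hy Ny nCy; apply: proj_sqr_traceless.
have /setIP[Hz /cent1P com] : (x ^ y^-1)%g \in ('C_H[x])%g.
  by rewrite memJ_norm ?groupV ?cent1_id.
have [E|E] := axis_conj ntx (det_square_commute Hx Hz (commute_sym com)).
  case/negP: nCy; rewrite in_setI Hy; apply/cent1P/proj_commute.
  move: E (traceless_add (A x)); move: (traceless _) (\tr _ / _) => X t E <-.
  by rewrite mulmxDr E mulmxDl scalar_mxC.
exact: (mx2_anticomm_trace two_neq0 (det_traceless_proj ntx) E).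
Qed.

Lemma faithful_of_proj_char0 : has_faithful_repr k [set: gT]%G 2.
Proof.
have [triv|/trivgPn[x _ ntx]] := eqVneq [set: gT]%g 1%g.
  have repr1 : mx_repr [set: gT]%g (fun _ : gT => 1%:M : 'M[k]_2).
    by split=> // x y _ _; rewrite mulmx1.
  by exists (MxRepresentation repr1); apply/subsetP => y _; rewrite -triv inE.
(* The traceless part of [A y] is then an axis that all of [G] preserves up to sign. *)
suff [y nty Hy] : exists2 y, y != 1%g &
    forall h, A y *m A (y ^ h^-1)%g = A (y ^ h^-1)%g *m A y.
  apply: (faithful_of_proj_axis two_neq0 projA (tr_traceless (A y))).
    exact: det_traceless_proj.
  by move=> h; apply: axis_conj.
have [H1|ntH] := eqVneq (H : {set gT}) 1%g.
  (* Conjugation changes the determinant by a square only, so the commutator of [x] and [h^-1] lies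
     in the trivial group [H]: any [x] is central. *)
  exists x => // h; suff -> : (x ^ h^-1)%g = x by [].
  apply/eqP; rewrite eq_sym eq_mulVg1 -in_set1 -[[set 1%g]]H1 inE.
  have [c E] := det_proj_conj x h^-1%g.
  have /det_squareM[t Et] : det_square (x^-1 * x)%g by have := group1 H; rewrite mulVg inE.
  apply/det_squareM; exists (c * t).
  by rewrite E mulrCA Et exprMn.
have [y Hy nC] := cent1_normal_exists det_square_cent1_abelian det_square_norm_cent1 ntH.
have [nty Hy1] := setD1P Hy; exists y => // h.
have Nh : (h^-1 \in 'N(H))%g.
  by rewrite inE; apply/subsetP => _ /imsetP[g Hg ->]; apply: det_square_conj.
have := conj_normal_cent1 det_square_cent1_abelian Hy Nh nC.
by case/setIP=> Hz /cent1P com; apply: det_square_commute => //; apply: commute_sym.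
Qed.

End CharacteristicZero.

(** * The field of rational functions *)

Lemma fraction_tofrac (R : idomainType) (y : {fraction R}) :
  exists a b : R, (b != 0 /\ y = FracField.tofrac a / FracField.tofrac b)%R.
Proof.
elim/quotW: y => x; exists \n_x, \d_x; split; first exact: denom_ratioP.
have dx0 : (FracField.tofrac \d_x != 0)%R by rewrite tofrac_eq0 denom_ratioP.
apply: (canRL (mulfK dx0)); rewrite /FracField.tofrac; unlock.
rewrite -[LHS]FracField.pi_mul; apply/eqP; rewrite FracField.equivf_def.
by rewrite /FracField.mulf !numden_Ratio ?mulf_neq0 ?denom_ratioP ?oner_neq0 //
  !mulr1 mulrC.
Qed.

Section RationalFunctions.
Local Open Scope ring_scope.
Variable k : fieldType.
Local Notation K := (ratfun 1 k).
Implicit Types (p q : {poly k}) (u y : K).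

HB.instance Definition _ := GRing.RMorphism.copy (@ratfunC 1 k)
  (@FracField.tofrac (mpoly 1 k) \o @mpolyC 1 k).

Definition ratX : K := FracField.tofrac (mpolyX k (mnm1 ord0)).

Definition peval p u : K := (map_poly (@ratfunC 1 k) p).[u].

Lemma pevalD p q u : peval (p + q) u = peval p u + peval q u.
Proof. by rewrite /peval rmorphD hornerD. Qed.
Lemma pevalB p q u : peval (p - q) u = peval p u - peval q u.
Proof. by rewrite /peval rmorphB hornerD hornerN. Qed.
Lemma pevalM p q u : peval (p * q) u = peval p u * peval q u.
Proof. by rewrite /peval rmorphM hornerM. Qed.
Lemma pevalC c u : peval c%:P u = ratfunC 1 c.
Proof. by rewrite /peval map_polyC hornerC. Qed.
Lemma pevalX u : peval 'X u = u.
Proof. by rewrite /peval map_polyX hornerX. Qed.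

Let mpoly_of p : mpoly 1 k := (map_poly (@mpolyC 1 k) p).[mpolyX k (mnm1 ord0)].

Lemma peval_ratX p : peval p ratX = FracField.tofrac (mpoly_of p).
Proof. by rewrite /peval /ratX /mpoly_of -horner_map -map_poly_comp. Qed.

Let mpoly_of_surj (P : mpoly 1 k) : exists p, P = mpoly_of p.
Proof.
exists (\sum_(m <- msupp P) (mcoeff m P)%:P * 'X^(m ord0)).
rewrite /mpoly_of rmorph_sum horner_sum [LHS]mpolyE; apply: eq_bigr => m _.
rewrite rmorphM /= map_polyC map_polyXn hornerM hornerC hornerXn.
rewrite -mul_mpolyC mpolyXn; congr (_ * mpolyX _ _).
by apply/mnmP => i; rewrite mulmnE mnm1E !ord1 eqxx mul1n.
Qed.

Lemma peval_ratX_inj p : peval p ratX = 0 -> p = 0.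
Proof.
rewrite peval_ratX => /eqP; rewrite tofrac_eq0 => /eqP E.
apply/polyP => i; rewrite coef0.
have := congr1 (mcoeff (mnm_muln (mnm1 ord0) i)) E.
rewrite mcoeff0 => E'; rewrite -[RHS]E' => {E E'}.
rewrite /mpoly_of horner_coef size_map_poly raddf_sum /=.
have deltaE j :
  (mnm_muln (mnm1 ord0) j == mnm_muln (mnm1 ord0) i :> multinom 1) = (j == i).
  apply/eqP/eqP => [/(congr1 (fun m : multinom 1 => m ord0))|->//].
  by rewrite !mulmnE mnm1E eqxx !mul1n.
have [ltip|] := ltnP i (size p).
  rewrite (bigD1 (Ordinal ltip)) //= coef_map mcoeffCM mcoeffXn eqxx mulr1.
  rewrite big1 => [|j]; [by rewrite addr0|rewrite -val_eqE /= => neji].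
  by rewrite coef_map mcoeffCM mcoeffXn deltaE (negPf neji) mulr0.
move=> lepi; rewrite nth_default //; apply/esym/big1 => j _.
rewrite coef_map mcoeffCM mcoeffXn deltaE ltn_eqF ?mulr0 //.
exact: leq_trans lepi.
Qed.

Lemma peval_ratX_neq0 p : p != 0 -> peval p ratX != 0.
Proof. by apply: contraNneq => /peval_ratX_inj ->. Qed.

Lemma ratfun_fraction y :
  exists p q, q != 0 /\ y = peval p ratX / peval q ratX.
Proof.
have [P [Q [Q0 ->]]] := fraction_tofrac y.
have [[p Ep] [q Eq]] := (mpoly_of_surj P, mpoly_of_surj Q).
exists p, q; rewrite !peval_ratX -Ep -Eq; split=> //.
by apply: contraNneq Q0 => q0; rewrite Eq q0 /mpoly_of rmorph0 horner0.
Qed.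
End RationalFunctions.

(** * Linear factors of polynomials in two variables *)

Section LinearFactor.
Local Open Scope ring_scope.
Variables (k L : fieldType) (phi : {rmorphism {poly k} -> L}).
Hypothesis phi_inj : injective phi.
Implicit Types (p q : {poly k}) (F G : {poly {poly k}}).

(** A form of Gauss's lemma. Clearing denominators shows that [q] divides the leading coefficient of
    [F], being coprime to [p]; adding the matching multiple of the linear factor cancels this
    coefficient, and induction on the size applies. *)
Lemma linear_factor p q F : coprimep p q -> q != 0 ->
  (map_poly phi F).[phi p / phi q] = 0 ->
  exists G, F = (p%:P - q%:P * 'X) * G.
Proof.
move=> co_pq q0; have [n] := ubnP (size F); elim: n F => // n IH F ltFn F0.
have phiq0 : phi q != 0 by rewrite -(inj_eq phi_inj) rmorph0 in q0.
have [->|nzF] := eqVneq F 0; first by exists 0; rewrite mulr0.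
case Em: (size F) => [|m]; first by move/eqP: Em nzF; rewrite size_poly_eq0 => ->.
have homog : \sum_(j < m.+1) F`_j * p ^+ j * q ^+ (m - j) = 0.
  apply: phi_inj; rewrite rmorph0 -[RHS](mul0r (phi q ^+ m)) -F0.
  rewrite horner_coef (size_map_inj_poly phi_inj) ?rmorph0 // Em.
  rewrite rmorph_sum mulr_suml; apply: eq_bigr => j _.
  rewrite !rmorphM !rmorphXn coef_map expr_div_n -!mulrA; congr (_ * (_ * _)).
  have lejm : (j <= m)%N by rewrite -ltnS.
  by rewrite -[X in _ = _ * _ ^+ X](subnK lejm) exprD mulrCA mulVf ?mulr1 ?expf_neq0.
case: m => [|m] in Em homog.
  have [c Fc] : exists c, F = c%:P by exists F`_0; apply: size1_polyC; rewrite Em.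
  case/eqP: nzF; rewrite Fc; move: homog; rewrite big_ord1 Fc coefC /= !expr0 !mulr1.
  by move->.
have [c Ec] : exists c : {poly k}, F`_m.+1 = q * c.
  suff /dvdpP[c ->] : q %| F`_m.+1 by exists c; rewrite mulrC.
  rewrite -(@Gauss_dvdpl _ _ (p ^+ m.+1)); last by rewrite coprimep_expr // coprimep_sym.
  move: homog; rewrite big_ord_recr /= subnn expr0 mulr1 => /eqP.
  rewrite addrC addr_eq0 => /eqP ->; rewrite dvdpNr.
  elim/big_rec: _ => [|j x _ IHx].
    exact: dvdp0.
  apply: dvdp_add => //; have ltjm : (j <= m)%N by rewrite -ltnS.
  by rewrite subSn // exprS mulrCA dvdp_mulr ?dvdpp.
have [G EG] : exists G, F + (p%:P - q%:P * 'X) * (c%:P * 'X^m) = (p%:P - q%:P * 'X) * G.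
  apply: IH; last first.
    rewrite rmorphD rmorphM hornerD hornerM F0 add0r rmorphB !rmorphM /=.
    rewrite !map_polyC map_polyX [in X in X * _]hornerD [in X in X * _]hornerN.
    rewrite hornerM !hornerC hornerX /=.
    by rewrite mulrCA divff // mulr1 subrr mul0r.
  apply: leq_trans (ltFn : (size F <= n)%N); rewrite Em ltnS.
  have -> : (p%:P - q%:P * 'X) * (c%:P * 'X^m) =
            (p * c)%:P * 'X^m - (q * c)%:P * 'X^(m.+1) :> {poly {poly k}}.
    by rewrite !polyCM exprS; ring.
  apply/leq_sizeP => j ltmj; rewrite coefD coefB !coefCM !coefXn gtn_eqF // mulr0 sub0r.
  have [->|nej] := eqVneq j m.+1; first by rewrite Ec mulr1 subrr.
  by rewrite mulr0 subr0 nth_default // Em ltn_neqAle eq_sym nej.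
exists (G - c%:P * 'X^m).
by rewrite mulrBr -EG addrK.
Qed.

(** After the swap, the coefficients are linear polynomials built from those of [p] and [q], which
    therefore cannot cancel each other. *)
Lemma size_linear_factor p q : let W := swapXY (p%:P - q%:P * 'X) in
  (size p <= size W)%N /\ (size q <= size W)%N.
Proof.
move=> W; have WE : W = p^:P - q^:P * 'X%:P.
  by rewrite /W rmorphB rmorphM /= !swapXY_polyC swapXY_X.
split; apply/leq_sizeP => i leWi.
  have := congr1 (fun r : {poly k} => r`_0) (nth_default 0 leWi).
  by rewrite WE coefB coefMC !coef_map /= coefB coefC coefMX eqxx subr0 coef0.
have := congr1 (fun r : {poly k} => r`_1) (nth_default 0 leWi).
rewrite WE coefB coefMC !coef_map /= coefB coefC coefMX /= coefC /= sub0r coef0.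
by move/eqP; rewrite oppr_eq0 => /eqP.
Qed.

Lemma swapXY_affine (r s : {poly k}) :
  swapXY ('X%:P * s^:P - r^:P) = 'X * s%:P - r%:P.
Proof. by rewrite rmorphB rmorphM /= !swapXY_map_polyC swapXY_Y. Qed.
End LinearFactor.

Section FieldIdentities.
Local Open Scope ring_scope.
Variable L : fieldType.
Implicit Types x y z t : L.

Lemma subf_div x y z t : y != 0 -> t != 0 ->
  x / y - z / t = (x * t - z * y) / (y * t).
Proof. by move=> y0 t0; field; rewrite y0 t0. Qed.

Lemma div_affine_comp p q r s a b c d x :
    c * x + d != 0 -> (r * a + s * c) * x + (r * b + s * d) != 0 ->
  (p * ((a * x + b) / (c * x + d)) + q) / (r * ((a * x + b) / (c * x + d)) + s) =
  ((p * a + q * c) * x + (p * b + q * d)) / ((r * a + s * c) * x + (r * b + s * d))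
  :> L.
Proof.
by move=> d1 d2; field; rewrite d2 d1.
Qed.

Lemma sub_affine_quadratic a b c d x :
  c * (x * x) + (d - a) * x - b = x * (c * x + d) - (a * x + b).
Proof. by ring. Qed.

End FieldIdentities.

(** * Automorphisms of [k(x)] and Moebius transformations *)

Section Moebius.
Local Open Scope ring_scope.
Variable k : fieldType.
Local Notation K := (ratfun 1 k).
Local Notation iota := (@ratfunC 1 k).
Local Notation X := (ratX k).
Implicit Types (p q r s : {poly k}) (u y : K) (f g : K -> K) (M N : 'M[k]_2).

Definition kalg_endo f : Prop := [/\ GRing.zmod_morphism f,
  GRing.monoid_morphism f & forall c : k, f (iota c) = iota c].

Lemma kalg_endo_peval f p u : kalg_endo f -> f (peval p u) = peval p (f u).
Proof.
move=> [fB fM fC].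
pose F : {rmorphism K -> K} := HB.pack f (GRing.isZmodMorphism.Build _ _ f fB)
  (GRing.isMonoidMorphism.Build _ _ f fM).
rewrite -[f]/(F : K -> K) /peval -horner_map -map_poly_comp; congr (_.[_]).
by apply: eq_map_poly => c /=; rewrite fC.
Qed.

Lemma kalg_endo_div f u y : kalg_endo f -> f (u / y) = f u / f y.
Proof.
move=> [fB fM fC].
pose F : {rmorphism K -> K} := HB.pack f (GRing.isZmodMorphism.Build _ _ f fB)
  (GRing.isMonoidMorphism.Build _ _ f fM).
by rewrite -[f]/(F : K -> K) fmorph_div.
Qed.

Lemma kalg_endo_eq f g : kalg_endo f -> kalg_endo g -> f X = g X -> f =1 g.
Proof.
move=> Ef Eg fgX y; have [p [q [_ ->]]] := ratfun_fraction y.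
by rewrite (kalg_endo_div _ _ Ef) (kalg_endo_div _ _ Eg) !(kalg_endo_peval _ _ Ef)
  !(kalg_endo_peval _ _ Eg) fgX.
Qed.

Lemma kalg_endo_comp f g : kalg_endo f -> kalg_endo g -> kalg_endo (f \o g).
Proof.
move=> [fB [f1 fM] fC] [gB [g1 gM] gC]; split.
- by move=> x y /=; rewrite gB fB.
- by split=> [|x y] /=; rewrite ?g1 // gM fM.
by move=> c /=; rewrite gC fC.
Qed.

Lemma kalg_endo_id : kalg_endo id. Proof. by []. Qed.

Let phi p : K := peval p X.
Let phi_zmod : GRing.zmod_morphism phi. Proof. by move=> p q; apply: pevalB. Qed.
Let phi_monoid : GRing.monoid_morphism phi.
Proof. by split=> [|p q]; rewrite /phi ?pevalM // -[1]/(1%:P) pevalC rmorph1. Qed.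
HB.instance Definition _ := GRing.isZmodMorphism.Build _ _ phi phi_zmod.
HB.instance Definition _ := GRing.isMonoidMorphism.Build _ _ phi phi_monoid.

Let phi_inj : injective phi.
Proof.
move=> p q E; apply/eqP; rewrite -subr_eq0; apply/eqP/peval_ratX_inj.
by rewrite pevalB; apply/eqP; rewrite subr_eq0; apply/eqP.
Qed.

Lemma map_phi_polyC r u : (map_poly phi r^:P).[u] = peval r u.
Proof.
rewrite -map_poly_comp /peval; congr (_.[_]).
by apply: eq_map_poly => c /=; rewrite /phi pevalC.
Qed.

(** By [linear_factor], [p - q T] divides [r(T)]. The latter is constant in the variable of [p] and
    [q], whereas the former has positive degree in it, so the quotient is zero. *)
Lemma peval_transcendental p q r : coprimep p q -> q != 0 ->
  (1 < maxn (size p) (size q))%N ->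
  peval r (peval p X / peval q X) = 0 -> r = 0.
Proof.
move=> co_pq q0 lt1; rewrite -map_phi_polyC => /(linear_factor phi_inj co_pq q0)[G].
have [->|nzG] := eqVneq G 0.
  by rewrite mulr0 => /eqP; rewrite map_polyC_eq0 => /eqP.
move=> /(congr1 (@swapXY k)); rewrite swapXY_map_polyC rmorphM /=.
have [] := size_linear_factor p q; set W := swapXY _ => lepW leqW.
have nzG' : swapXY G != 0 by rewrite swapXY_eq0.
have ltW : (1 < size W)%N by apply: leq_trans lt1 _; rewrite geq_max lepW.
have nzW : W != 0 by rewrite -size_poly_gt0; apply: leq_trans ltW.
move=> /(congr1 (fun F : {poly {poly k}} => size F)).
rewrite size_mul // size_polyC => sz; have := size_poly_gt0 (swapXY G).
rewrite nzG'; move: sz ltW; case: (r =P 0) => // _ /=.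
by case: (size W) => [|[|a]] //; case: (size (swapXY G)) => // b; rewrite !addSn addnS.
Qed.

Definition moebius M u : K :=
  (iota (M 0 0) * u + iota (M 0 1)) / (iota (M 1 0) * u + iota (M 1 1)).

Lemma moebiusE a b c d u :
  moebius (mx2 a b c d) u = (iota a * u + iota b) / (iota c * u + iota d).
Proof. by rewrite /moebius !mxE. Qed.

Lemma affine_ratX_eq0 a b : iota a * X + iota b = 0 -> a = 0 /\ b = 0.
Proof.
have -> : iota a * X + iota b = peval (a%:P * 'X + b%:P) X.
  by rewrite pevalD pevalM !pevalC pevalX.
move/peval_ratX_inj/polyP => E; split.
  by have := E 1%N; rewrite coefD coefMX !coefC /= addr0 ?coef0.
by have := E 0%N; rewrite coefD coefMX !coefC /= add0r ?coef0.
Qed.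

Lemma moebius_denom_neq0 a b c d : \det (mx2 a b c d) != 0 ->
  iota c * X + iota d != 0.
Proof.
rewrite det_mx2; apply: contraNneq => /affine_ratX_eq0[-> ->].
by rewrite !mulr0 subrr.
Qed.

Let iotaD (a b : k) : iota (a + b) = iota a + iota b :> K. Proof. exact: rmorphD. Qed.
Let iotaM (a b : k) : iota (a * b) = iota a * iota b :> K. Proof. exact: rmorphM. Qed.

Lemma moebiusM M N : \det M != 0 -> \det N != 0 ->
  moebius M (moebius N X) = moebius (M *m N) X.
Proof.
move=> dM dN; have : \det (M *m N) != 0 by rewrite det_mulmx mulf_neq0.
move: dM dN; have [p [q [r [s ->]]]] := mx2P M; have [a [b [c [d ->]]]] := mx2P N.
rewrite mx2M => dM /moebius_denom_neq0 dN /moebius_denom_neq0 dMN.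
rewrite !moebiusE; move: dMN; rewrite !iotaD !iotaM => dMN.
exact: (div_affine_comp (iota p) (iota q) dN dMN).
Qed.

Lemma moebius_scalar x : x != 0 -> moebius x%:M X = X.
Proof.
move=> x0; rewrite mx2_scalar moebiusE rmorph0 mul0r addr0 add0r mulrC mulKf //.
by rewrite fmorph_eq0.
Qed.

Lemma moebius_id_scalar M : \det M != 0 -> moebius M X = X -> is_scalar_mx M.
Proof.
have [a [b [c [d ->]]]] := mx2P M => /moebius_denom_neq0 dM; rewrite moebiusE.
move/(congr1 (fun y => y * (iota c * X + iota d))); rewrite divfK // => E.
have : peval (c%:P * 'X^2 + (d - a)%:P * 'X - b%:P) X = 0.
  rewrite pevalB pevalD !pevalM !pevalC !pevalX.
  have -> : iota (d - a) = iota d - iota a by exact: rmorphB.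
  by rewrite sub_affine_quadratic E subrr.
move/peval_ratX_inj/polyP => E'; rewrite is_scalar_mx2.
have := E' 0%N; have := E' 1%N; have := E' 2%N.
rewrite !coefB !coefD !coefMX !coefCM !coefXn !coefC /= !mulr0 !mulr1.
rewrite !(addr0, add0r, subr0, sub0r) => -> /eqP + /eqP.
by rewrite oppr_eq0 subr_eq0 eqxx eq_sym => -> ->.
Qed.

Lemma det_adj_neq0 M : \det M != 0 -> \det (\adj M) != 0.
Proof.
move=> dM; apply: contraNneq dM => dA.
have := congr1 determinant (mul_adj_mx M).
rewrite det_mulmx dA mul0r det_scalar => /esym/eqP.
by rewrite expf_eq0 => /andP[].
Qed.

Lemma moebius_eq M N : \det M != 0 -> \det N != 0 ->
  moebius M X = moebius N X -> exists c, M = c *: N.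
Proof.
move=> dM dN E; have dA := det_adj_neq0 dN.
have /is_scalar_mxP[x Ex] : is_scalar_mx (\adj N *m M).
  apply: moebius_id_scalar; first by rewrite det_mulmx mulf_neq0.
  by rewrite -moebiusM // E moebiusM // mul_adj_mx moebius_scalar.
exists (x / \det N).
have := mul_mx_adj N; move/(congr1 (fun P => P *m M)); rewrite -mulmxA Ex.
rewrite mul_mx_scalar mul_scalar_mx => /(congr1 (fun P => (\det N)^-1 *: P)).
by rewrite !scalerA mulVf // scale1r mulrC => ->.
Qed.

Lemma cremona_endo (f : cremona 1 k) : kalg_endo (cremona_fun f).
Proof. by have [] := asboolW (cremona_funP f). Qed.

Lemma cremona_fun_inj (f : cremona 1 k) : injective (cremona_fun f).
Proof. by have [_ _ _ /bij_inj] := asboolW (cremona_funP f). Qed.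

Lemma kalg_endo0 f : kalg_endo f -> f 0 = 0.
Proof. by move=> [fB _ _]; rewrite -[in LHS](subrr 0) fB subrr. Qed.

Lemma ratfun_coprime_fraction y :
  exists p q, [/\ coprimep p q, q != 0 & y = peval p X / peval q X].
Proof.
have [p [q [q0 ->]]] := ratfun_fraction y; set d := gcdp p q.
have d0 : d != 0 by rewrite gcdp_eq0 negb_and q0 orbT.
have Ep : p = p %/ d * d by rewrite divpK ?dvdp_gcdl.
have Eq : q = q %/ d * d by rewrite divpK ?dvdp_gcdr.
exists (p %/ d), (q %/ d); have nzq : q %/ d != 0.
  by apply: contraNneq q0 => q0; rewrite Eq q0 mul0r.
split=> //; first by rewrite coprimep_div_gcd // q0 orbT.
rewrite [in LHS]Ep [in LHS]Eq !pevalM -mulf_div divff ?mulr1 //.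
exact: peval_ratX_neq0.
Qed.

Lemma cremona_moebius (f : cremona 1 k) :
  exists2 M, \det M != 0 & cremona_fun f X = moebius M X.
Proof.
have Ef := cremona_endo f; have fI := @cremona_fun_inj f.
have f_eq0 y : cremona_fun f y = 0 -> y = 0.
  by move=> fy0; apply: fI; rewrite fy0 (kalg_endo0 Ef).
have [p [q [co_pq q0 Eu]]] := ratfun_coprime_fraction (cremona_fun f X).
have [_ _ fC [f' _ fK]] := asboolW (cremona_funP f).
have [r [s [s0 Ey]]] := ratfun_fraction (f' X).
have su0 : peval s (cremona_fun f X) != 0.
  apply: contraNneq s0; rewrite -(kalg_endo_peval _ _ Ef) => /f_eq0.
  by move/peval_ratX_inj->.
have EX : X = peval r (cremona_fun f X) / peval s (cremona_fun f X).
  by rewrite -!(kalg_endo_peval _ _ Ef) -(kalg_endo_div _ _ Ef) -Ey fK.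
(* The inner variable stands for [X], the outer one for its image [u = p / q]. By [EX], [F] vanishes
   at [u]; having inner degree 1, it bounds the degrees of [p] and [q] by 1. *)
pose F : {poly {poly k}} := 'X%:P * s^:P - r^:P.
have [G EF] : exists G, F = (p%:P - q%:P * 'X) * G.
  apply: (linear_factor phi_inj co_pq q0); rewrite -[phi p / phi q]Eu.
  rewrite /F rmorphB rmorphM /= map_polyC /= hornerD hornerN hornerM hornerC.
  by rewrite !map_phi_polyC /phi pevalX [in X in X * _]EX divfK // subrr.
have FE : swapXY F = 'X * s%:P - r%:P by apply: swapXY_affine.
have nzF : swapXY F != 0.
  apply: contraNneq s0; rewrite FE => /polyP/(_ 1%N).
  by rewrite coefB coefXM !coefC /= subr0 => ->; rewrite ?coef0.
have szF : (size (swapXY F) <= 2)%N.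
  apply/leq_sizeP => j lt1j; rewrite FE coefB coefXM !coefC.
  by case: j lt1j => [|[|j]] //= _; rewrite subr0.
have [lepW leqW] := size_linear_factor p q.
move: szF nzF; rewrite EF rmorphM mulf_eq0 negb_or => szF /andP[nzW nzG].
have leW : (size (swapXY (p%:P - q%:P * 'X)) <= 2)%N.
  apply: leq_trans szF; rewrite size_mul //.
  move: nzG; rewrite -size_poly_gt0; case: (size (swapXY G)) => // n _.
  by rewrite addnS leq_addr.
have lin (t : {poly k}) : (size t <= 2)%N -> t = (t`_1)%:P * 'X + (t`_0)%:P.
  move=> szt; apply/polyP => -[|[|i]]; rewrite coefD coefMX !coefC /= ?addr0 ?add0r //.
  by rewrite nth_default // (leq_trans szt).
have evlin (t : {poly k}) : (size t <= 2)%N -> peval t X = iota t`_1 * X + iota t`_0.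
  by move=> /lin {1}->; rewrite pevalD pevalM !pevalC pevalX.
have uE : cremona_fun f X = moebius (mx2 p`_1 p`_0 q`_1 q`_0) X.
  by rewrite moebiusE Eu !evlin ?(leq_trans lepW) ?(leq_trans leqW).
exists (mx2 p`_1 p`_0 q`_1 q`_0) => //; rewrite det_mx2 subr_eq0.
apply: contraNneq (q0) => det0.
have qu : cremona_fun f X * peval q X = peval p X by rewrite Eu divfK ?peval_ratX_neq0.
(* With determinant 0, [p] and [q] would be proportional and the image of [X] a constant.
   Injectivity of [f] excludes this and leaves only [q = 0]. *)
have prop a b : a%:P * q = b%:P * p -> b = 0.
  move=> E; have : iota b * X + iota (- a) = 0.
    apply: f_eq0; have [fB [_ fM] _] := Ef.
    rewrite rmorphN fB fM !fC; apply/eqP; rewrite subr_eq0; apply/eqP.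
    apply: (mulIf (peval_ratX_neq0 q0)).
    by rewrite -mulrA qu -!(pevalC _ X) -!pevalM E.
  by case/affine_ratX_eq0.
have Ep := lin p (leq_trans lepW leW); have Eq := lin q (leq_trans leqW leW).
apply/eqP; rewrite Eq.
have -> : q`_1 = 0.
  apply: (prop p`_1); rewrite [X in _ * X = _]Eq [X in _ = _ * X]Ep.
  rewrite !mulrDr !mulrA -!polyCM det0.
  by rewrite (mulrC q`_1 p`_1) (mulrC q`_1 p`_0).
have -> : q`_0 = 0.
  apply: (prop p`_0); rewrite [X in _ * X = _]Eq [X in _ = _ * X]Ep.
  rewrite !mulrDr !mulrA -!polyCM -det0.
  by rewrite (mulrC q`_0 p`_1) (mulrC q`_0 p`_0).
by rewrite mul0r addr0.
Qed.

(** This is substitution of [u] for the variable. Each element gets an arbitrarily chosen fraction;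
    [fE] shows that the value does not depend on it, no nonzero denominator vanishing at [u]. *)
Lemma kalg_endo_exists u : (forall r, peval r u = 0 -> r = 0) ->
  exists2 f, kalg_endo f & f X = u.
Proof.
move=> tr_u; have tr r : r != 0 -> peval r u != 0 by apply: contraNneq => /tr_u->.
have /choice[F HF] : forall y, exists F : {poly k} * {poly k},
    F.2 != 0 /\ y = peval F.1 X / peval F.2 X.
  by move=> y; have [p [q H]] := ratfun_fraction y; exists (p, q).
pose f y := peval (F y).1 u / peval (F y).2 u.
have fE p q : q != 0 -> f (peval p X / peval q X) = peval p u / peval q u.
  move=> q0; rewrite /f; have [] := HF (peval p X / peval q X).
  move: (F _) => [r s] /= s0 /eqP; rewrite eqr_div ?peval_ratX_neq0 // -!pevalM.
  move=> /eqP/phi_inj E; apply/eqP; rewrite eqr_div ?tr // -!pevalM; apply/eqP.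
  by rewrite -E.
have fE1 p : f (peval p X) = peval p u.
  by have := fE p 1 (oner_neq0 _); rewrite -[1]/(1%:P) !pevalC rmorph1 !divr1.
exists f; last by rewrite -[in LHS](pevalX X) fE1 pevalX.
split=> [x y||c]; last by rewrite -(pevalC c X) fE1 !pevalC.
- have [p [q [q0 ->]]] := ratfun_fraction x; have [r [s [s0 ->]]] := ratfun_fraction y.
  rewrite subf_div ?peval_ratX_neq0 // -!pevalM -pevalB !fE ?mulf_neq0 //.
  by rewrite pevalB !pevalM -subf_div ?tr.
split=> [|x y].
  have i1 : iota 1 = 1 :> K by exact: rmorph1.
  by rewrite -[LHS]/(f 1) -[Y in f Y]i1 -(pevalC 1 X) fE1 pevalC i1.
have [p [q [q0 ->]]] := ratfun_fraction x; have [r [s [s0 ->]]] := ratfun_fraction y.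
by rewrite mulf_div -!pevalM !fE ?mulf_neq0 // !pevalM mulf_div.
Qed.

Lemma kalg_endo_moebius f M u : kalg_endo f -> f (moebius M u) = moebius M (f u).
Proof.
have [a [b [c [d ->]]]] := mx2P M => Ef; rewrite !moebiusE (kalg_endo_div _ _ Ef).
have aff (x t : k) : iota x * u + iota t = peval (x%:P * 'X + t%:P) u.
  by rewrite pevalD pevalM !pevalC pevalX.
by rewrite !aff !(kalg_endo_peval _ _ Ef) !pevalD !pevalM !pevalC pevalX.
Qed.

Lemma moebius_transcendental M r : \det M != 0 -> peval r (moebius M X) = 0 -> r = 0.
Proof.
have [a [b [c [d ->]]]] := mx2P M; rewrite det_mx2 => dM; rewrite moebiusE.
have aff (x t : k) : iota x * X + iota t = peval (x%:P * 'X + t%:P) X.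
  by rewrite pevalD pevalM !pevalC pevalX.
have sz (x t : k) : x != 0 -> size (x%:P * 'X + t%:P) = 2.
  by move=> x0; rewrite size_MXaddC polyC_eq0 (negPf x0) size_polyC x0.
rewrite !aff; apply: peval_transcendental.
- apply/Bezout_coprimepP; exists (c%:P, - a%:P) => /=.
  have -> : c%:P * (a%:P * 'X + b%:P) + - a%:P * (c%:P * 'X + d%:P) =
            (- (a * d - b * c))%:P.
    by rewrite polyCN polyCB !polyCM; ring.
  by rewrite polyC_eqp1 oppr_eq0.
- apply: contraNneq dM => E; have := congr1 (fun t : {poly k} => t`_0) E.
  have := congr1 (fun t : {poly k} => t`_1) E.
  rewrite /= !coefD !coefMX !coefC /= addr0 add0r ?coef0 => -> ->.
  by rewrite !mulr0 subr0.
rewrite leq_max; have [a0|a0] := eqVneq a 0; last by rewrite sz.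
rewrite (sz c d) ?orbT //; apply: contraNneq dM => ->.
by rewrite a0 mul0r mulr0 subr0.
Qed.

(** The adjugate matrix provides the inverse substitution. *)
Lemma cremona_of_moebius M : \det M != 0 ->
  exists f : cremona 1 k, cremona_fun f X = moebius M X.
Proof.
move=> dM; have dA := det_adj_neq0 dM.
have [f Ef fX] := kalg_endo_exists (fun r => @moebius_transcendental M r dM).
have [g Eg gX] := kalg_endo_exists (fun r => @moebius_transcendental _ r dA).
have fgK : cancel g f.
  apply: (kalg_endo_eq (kalg_endo_comp Ef Eg) kalg_endo_id) => /=.
  by rewrite gX (kalg_endo_moebius _ _ Ef) fX moebiusM // mul_adj_mx moebius_scalar.
have gfK : cancel f g.
  apply: (kalg_endo_eq (kalg_endo_comp Eg Ef) kalg_endo_id) => /=.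
  by rewrite fX (kalg_endo_moebius _ _ Eg) gX moebiusM // mul_mx_adj moebius_scalar.
have autf : is_kalg_aut f by have [? ? ?] := Ef; split=> //; exists g.
by exists (Cremona (asboolT autf)).
Qed.

End Moebius.

(** * Subgroups and lower bounds *)

Section FiniteSubgroups.
Local Open Scope group_scope.
Variable T : groupType.
Implicit Types (S V C : seq T) (u v w : T).

(** Left translations of a finite set closed under products are injective, hence surjective, so
    inverses come for free. *)
Lemma finite_subgroup S : 1 \in S -> {in S &, forall x y, x * y \in S} ->
  exists (gT : finGroupType) (f : {multiplicative gT -> T}),
    injective f /\ {in S, forall x, exists g, f g = x}.
Proof.
move=> S1 SM; pose sT := seq_sub S.
pose one : sT := SeqSub S1.
pose mul (x y : sT) : sT := SeqSub (SM _ _ (valP x) (valP y)).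
have mulA : associative mul by move=> x y z; apply: val_inj; rewrite /= mulgA.
have mul1 : left_id one mul by move=> x; apply: val_inj; rewrite /= mul1g.
have mulI x : injective (mul x) by move=> y z /(congr1 val)/mulgI/val_inj.
have ex_inv x : exists y, mul y x == one.
  have [g _ gK] := injF_bij (mulI x).
  exists (g one); apply/eqP/(mulI x); rewrite mulA gK mul1.
  by apply: val_inj; rewrite /= mulg1.
pose inv x := xchoose (ex_inv x).
have mulV : left_inverse one inv mul by move=> x; apply/eqP/(xchooseP (ex_inv x)).
pose gT : finGroupType := HB.pack sT (Finite_isGroup.Build sT mulA mul1 mulV).
pose val_gT (x : gT) : T := ssval (x : sT).
have valM : {morph val_gT : x y / x * y} by [].
pose f : {multiplicative gT -> T} :=
  HB.pack val_gT (isMultiplicative.Build gT T val_gT valM).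
exists gT, f; split=> [x y|x Sx]; first by move/val_inj.
by exists (SeqSub Sx).
Qed.

Lemma finite_product_subgroup V C : 1 \in V -> 1 \in C ->
    {in V &, forall x y, x * y \in V} -> {in C &, forall x y, x * y \in C} ->
    {in C & V, forall c a, exists2 a', a' \in V & c * a = a' * c} ->
  exists (gT : finGroupType) (f : {multiplicative gT -> T}), injective f /\
    forall a c, a \in V -> c \in C -> exists g, f g = a * c.
Proof.
move=> V1 C1 VM CM twist; pose S := [seq a * c | a <- V, c <- C].
have memS a c : a \in V -> c \in C -> a * c \in S by move=> *; apply: allpairs_f.
have [||gT [f [fI fS]]] := @finite_subgroup S.
- by rewrite -[1]mulg1 memS.
- move=> _ _ /allpairsP[[a c] /= [Va Cc ->]] /allpairsP[[b d] /= [Vb Cd ->]].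
  have [b' Vb' E] := twist c b Cc Vb.
  have -> : a * c * (b * d) = a * b' * (c * d).
    by rewrite -!mulgA [c * (b * d)]mulgA E !mulgA.
  by rewrite memS ?VM ?CM.
by exists gT, f; split=> // a c Va Cc; apply/fS/memS.
Qed.

Lemma mem_cycle3M w : w * w * w = 1 ->
  {in [:: 1; w; w * w] &, forall x y, x * y \in [:: 1; w; w * w]}.
Proof.
move=> w3 x y; rewrite !inE; have w4 : w * w * (w * w) = w by rewrite mulgA w3 mul1g.
move=> /or3P[] /eqP-> /or3P[] /eqP->;
  by rewrite ?(mul1g, mulg1) ?w4 ?mulgA ?w3 !eqxx ?orbT.
Qed.

(** The relations are those of [S_3]. They make the six products closed even if some coincide;
    noncommutativity is checked separately on the matrices. *)
Lemma dihedral3_subgroup u w : u * u = 1 -> w * w * w = 1 -> u * w = w * w * u ->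
  exists (gT : finGroupType) (f : {multiplicative gT -> T}),
    [/\ injective f, exists g, f g = u & exists g, f g = w].
Proof.
move=> u2 w3 uw; have [|||||gT [f [fI fS]]] :=
    @finite_product_subgroup [:: 1; w; w * w] [:: 1; u].
- by rewrite inE eqxx.
- by rewrite inE eqxx.
- exact: mem_cycle3M.
- by move=> x y; rewrite !inE => /orP[] /eqP-> /orP[] /eqP->;
    rewrite ?(mul1g, mulg1) ?u2 eqxx ?orbT.
- move=> c a; rewrite !inE => /orP[] /eqP-> Va.
    by exists a; rewrite ?mul1g ?mulg1 // !inE.
  move: Va => /or3P[] /eqP->.
  + by exists 1; rewrite ?mulg1 ?mul1g // inE eqxx.
  + by exists (w * w); rewrite // !inE eqxx !orbT.
  exists w; first by rewrite !inE eqxx !orbT.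
  by rewrite mulgA uw -!mulgA uw !mulgA w3 mul1g.
exists gT, f; split=> //.
  by rewrite -[u]mul1g; apply: fS; rewrite !inE eqxx ?orbT.
by rewrite -[w]mulg1; apply: fS; rewrite !inE eqxx ?orbT.
Qed.

(** The relations are those of [A_4]: conjugation by [w] permutes [u], [v] and [u * v]
    cyclically. *)
Lemma tetrahedral_subgroup u v w : u * u = 1 -> v * v = 1 -> u * v = v * u ->
    w * w * w = 1 -> w * u = v * w -> w * v = u * v * w ->
  exists (gT : finGroupType) (f : {multiplicative gT -> T}),
    [/\ injective f, exists g, f g = u, exists g, f g = v & exists g, f g = w].
Proof.
move=> u2 v2 uv w3 wu wv; pose V := [:: 1; u; v; u * v].
have vuv : v * (u * v) = u by rewrite mulgA -uv -mulgA v2 mulg1.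
have uuv : u * (u * v) = v by rewrite mulgA u2 mul1g.
have uvu : u * v * u = v by rewrite uv -mulgA u2 mulg1.
have uvv : u * v * v = u by rewrite -mulgA v2 mulg1.
have uvuv : u * v * (u * v) = 1 by rewrite -mulgA vuv.
have memV x : (x \in V) = [|| x == 1, x == u, x == v | x == u * v] by rewrite !inE.
have twist a : a \in V -> exists2 a', a' \in V & w * a = a' * w.
  rewrite memV => /or4P[] /eqP->.
  - by exists 1; rewrite ?mulg1 ?mul1g // memV eqxx.
  - by exists v; rewrite // memV eqxx !orbT.
  - by exists (u * v); rewrite // memV eqxx !orbT.
  exists u; first by rewrite memV eqxx !orbT.
  by rewrite mulgA wu -mulgA wv mulgA vuv.
have [|||||gT [f [fI fS]]] := @finite_product_subgroup V [:: 1; w; w * w].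
- by rewrite memV eqxx.
- by rewrite inE eqxx.
- move=> x y; rewrite !memV => /or4P[] /eqP-> /or4P[] /eqP->;
  by rewrite ?(mul1g, mulg1) ?(vuv, uuv, uvu, uvv, uvuv, u2, v2) -?uv ?eqxx ?orbT.
- exact: mem_cycle3M.
- move=> c a Cc Va; move: Cc; rewrite !inE => /or3P[] /eqP->.
  + by exists a; rewrite ?mul1g ?mulg1.
  + exact: twist.
  have [a' Va' E] := twist a Va; have [b Vb E'] := twist a' Va'.
  by exists b => //; rewrite -mulgA E mulgA E' mulgA.
exists gT, f; split=> //.
- by rewrite -[u]mulg1; apply: fS; [rewrite memV eqxx ?orbT|rewrite inE eqxx].
- by rewrite -[v]mulg1; apply: fS; [rewrite memV eqxx ?orbT|rewrite inE eqxx].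
by rewrite -[w]mul1g; apply: fS; [rewrite memV eqxx|rewrite !inE eqxx ?orbT].
Qed.

End FiniteSubgroups.

Section FaithfulLowerBounds.
Local Open Scope ring_scope.
Variables (k : fieldType) (gT : finGroupType).

Lemma mx_small_comm N (M M' : 'M[k]_N) : (N <= 1)%N -> M *m M' = M' *m M.
Proof.
case: N M M' => [|[|//]] M M' _; first by rewrite [LHS]flatmx0 [RHS]flatmx0.
by rewrite [M]mx11_scalar scalar_mxC.
Qed.

Lemma faithful_noncommutative (u w : gT) N : (u * w)%g <> (w * u)%g ->
  has_faithful_repr k [set: gT]%G N -> (2 <= N)%N.
Proof.
move=> ncuw [rG faith]; rewrite ltnNge; apply/negP => leN1; apply: ncuw.
apply: (mx_faithful_inj faith); rewrite ?inE // !repr_mxM ?inE //.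
exact: mx_small_comm.
Qed.

(** Degrees 0 and 1 are excluded by commutativity. In degree 2, the conjugations by [w] force [u]
    and [v] to have determinant 1. By Cayley-Hamilton the trace of [u] times [u] is the nonzero
    scalar 2, so [u] is scalar and commutes with [w], and [u = v]. *)
Lemma faithful_tetrahedral (u v w : gT) N : (2%:R : k) != 0 -> u != v ->
    (u * u = 1)%g -> (w * u = v * w)%g -> (w * v = u * v * w)%g ->
  has_faithful_repr k [set: gT]%G N -> (3 <= N)%N.
Proof.
move=> two_neq0 neuv u2 wu wv [rG faith]; rewrite ltnNge; apply/negP => leN2.
have inT (x : gT) : x \in [set: gT]%G by rewrite inE.
have uv_eq : rG w *m rG u = rG u *m rG w -> False.
  move=> E; case/eqP: neuv; apply: (mulIg w); rewrite -wu.
  by apply: (mx_faithful_inj faith) => //; rewrite !repr_mxM.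
have [leN1|] := leqP N 1; first by apply: uv_eq; apply: mx_small_comm.
move=> lt1N; have N2 : N = 2 by apply/eqP; rewrite eqn_leq leN2.
subst N; apply: uv_eq.
have ru x : \det (rG x) != 0.
  by rewrite -unitfE -unitmxE repr_mx_unit.
have dv : \det (rG v) = \det (rG u).
  apply: (mulIf (ru w)); rewrite -!det_mulmx -!repr_mxM // -wu.
  by rewrite !repr_mxM // !det_mulmx mulrC.
have du : \det (rG u) = 1.
  apply: (mulIf (ru v)); apply: (mulIf (ru w)); rewrite mul1r.
  by rewrite -!det_mulmx -!repr_mxM // -wv !repr_mxM // !det_mulmx mulrC.
have : rG u *m rG u = 1%:M by rewrite -repr_mxM // u2 repr_mx1.
move: du; have [a [b [c [d ->]]]] := mx2P (rG u); rewrite det_mx2 => du.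
rewrite mx2M mx2_scalar => /mx2_inj[E1 E2 E3 E4].
have t0 : a + d != 0.
  apply: contraNneq two_neq0 => t0; apply/eqP.
  transitivity ((a * a + b * c) + (a * d - b * c)); first by rewrite E1 du.
  by transitivity (a * (a + d)); [ring | rewrite t0 mulr0].
have b0 : b = 0.
  by apply: (mulIf t0); rewrite mul0r -[RHS]E2; ring.
have c0 : c = 0.
  by apply: (mulIf t0); rewrite mul0r -[RHS]E3; ring.
have a0 : a != 0.
  by apply: contraNneq t0 => a0; move: E1; rewrite a0 b0 !mul0r addr0 => /esym/eqP;
    rewrite oner_eq0.
have -> : d = a.
  by apply: (mulfI a0); apply: (eq_of_sub (congr2 (fun x y => x - y) du E1)); rewrite b0; ring.
by rewrite b0 c0 -mx2_scalar scalar_mxC.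
Qed.

End FaithfulLowerBounds.

(** * The Cremona group of the line and its subgroups [S_3] and [A_4] *)

Section CremonaGroupOfTheLine.
Local Open Scope ring_scope.
Variable k : fieldType.
Local Notation K := (ratfun 1 k).
Local Notation X := (ratX k).

Lemma cremona_ext (f g : cremona 1 k) :
  cremona_fun f X = cremona_fun g X -> f = g.
Proof.
move=> E; apply: val_inj; apply/funext.
exact: (kalg_endo_eq (cremona_endo f) (cremona_endo g) E).
Qed.

(** The factors come out reversed because [f] fixes the coefficients of [N] and acts on the variable
    inside. *)
Lemma cremonaM_moebius (f g : cremona 1 k) M N : \det M != 0 -> \det N != 0 ->
    cremona_fun f X = moebius M X -> cremona_fun g X = moebius N X ->
  cremona_fun (f * g)%g X = moebius (N *m M) X.
Proof.
move=> dM dN fX gX; rewrite -[LHS]/(cremona_fun f (cremona_fun g X)) gX.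
by rewrite (kalg_endo_moebius _ _ (cremona_endo f)) fX moebiusM.
Qed.

Lemma multiplicative1 (gT : finGroupType) (T : groupType)
  (f : {multiplicative gT -> T}) : f 1%g = 1%g.
Proof. by apply: (mulgI (f 1%g)); rewrite -gmulfM !mulg1. Qed.

Lemma proj_faithful_of_cremona (gT : finGroupType)
    (f : {multiplicative gT -> cremona 1 k}) : injective f ->
  exists A : gT -> 'M[k]_2, proj_faithful A.
Proof.
move=> fI; have /choice[M HM] : forall g, exists M : 'M[k]_2,
    \det M != 0 /\ cremona_fun (f g) X = moebius M X.
  by move=> g; have [M dM E] := cremona_moebius (f g); exists M.
have dM g : \det (M g) != 0 by case: (HM g).
have MX g : cremona_fun (f g) X = moebius (M g) X by case: (HM g).
(* The transpose restores the order of the factors. *)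
exists (fun g => (M g)^T); split=> [g|g h|g]; first by rewrite det_tr.
  have [||c E] := @moebius_eq k (M h *m M g) (M (g * h)%g) _ (dM _).
  - by rewrite det_mulmx mulf_neq0.
  - by rewrite -(cremonaM_moebius (dM g) (dM h) (MX g) (MX h)) -MX gmulfM.
  by exists c; rewrite -trmx_mul E linearZ.
case/is_scalar_mxP=> x E; apply: fI; rewrite multiplicative1; apply: cremona_ext.
have {}E : M g = x%:M by rewrite -[M g]trmxK E tr_scalar_mx.
rewrite MX E moebius_scalar //.
by apply: contraNneq (dM g) => x0; rewrite E x0 det_scalar expr0n.
Qed.

(** On invertible matrices [P] is an antihomomorphism with the scalars as kernel, so relations in
    the Cremona group can be checked on matrices up to scalars. *)
Lemma cremona_matrix_action : exists P : 'M[k]_2 -> cremona 1 k,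
  [/\ forall M N, \det M != 0 -> \det N != 0 -> (P M * P N)%g = P (N *m M),
      forall c M, c != 0 -> \det M != 0 -> P (c *: M) = P M,
      P 1%:M = 1%g
    & forall M N, \det M != 0 -> \det N != 0 -> P M = P N ->
        exists c, M = c *: N].
Proof.
have /choice[P HP] : forall M : 'M[k]_2, exists f : cremona 1 k,
    \det M != 0 -> cremona_fun f X = moebius M X.
  move=> M; have [d0|dM] := eqVneq (\det M) 0; first by exists 1%g.
  by have [f fX] := cremona_of_moebius dM; exists f.
have d1 : \det (1%:M : 'M[k]_2) != 0 by rewrite det1 oner_eq0.
have PM M N : \det M != 0 -> \det N != 0 -> (P M * P N)%g = P (N *m M).
  move=> dM dN; apply: cremona_ext; rewrite (cremonaM_moebius dM dN) ?HP //.
  by rewrite det_mulmx mulf_neq0.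
have scal c : c != 0 -> P c%:M = 1%g.
  move=> c0; apply: cremona_ext; rewrite HP ?moebius_scalar //.
  by rewrite det_scalar expf_neq0.
exists P; split=> // [c M c0 dM||M N dM dN E].
- by rewrite -mul_mx_scalar -PM ?scal ?mul1g // det_scalar expf_neq0.
- exact/scal/oner_neq0.
by apply: (moebius_eq dM dN); rewrite -!HP // E.
Qed.

Lemma cremona_noncommutative_subgroup :
  exists (gT : finGroupType) (f : {multiplicative gT -> cremona 1 k}),
    injective f /\ exists u w : gT, (u * w)%g <> (w * u)%g.
Proof.
have [P [PM PZ P1 PI]] := cremona_matrix_action.
(* These are [1 / x] and [1 / (1 - x)], which permute 0, 1 and infinity in every characteristic. *)
pose U := mx2 (0 : k) 1 1 0; pose W := mx2 (0 : k) (-1) 1 (-1).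
have dU : \det U != 0 by rewrite det_mx2 mul0r mulr1 sub0r oppr_eq0 oner_eq0.
have dW : \det W != 0 by rewrite det_mx2 mul0r mulr1 sub0r opprK oner_eq0.
have dWW : \det (W *m W) != 0 by rewrite det_mulmx mulf_neq0.
have dWU : \det (W *m U) != 0 by rewrite det_mulmx mulf_neq0.
have [|||gT [f [fI [u fu] [w fw]]]] := @dihedral3_subgroup _ (P U) (P W).
- by rewrite PM // -P1; congr P; rewrite !mx2E; congr mx2; ring.
- by rewrite !PM // -P1; congr P; rewrite !mx2E; congr mx2; ring.
- by rewrite !PM //; congr P; rewrite !mx2E; congr mx2; ring.
exists gT, f; split=> //; exists u, w => E.
have := congr1 f E; rewrite !gmulfM fu fw !PM // => /PI[||c].
- by rewrite det_mulmx mulf_neq0.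
- by rewrite det_mulmx mulf_neq0.
rewrite !mx2E => /mx2_inj[E1 E2 _ _].
have c0 : c = 0 by apply: oppr_inj; rewrite oppr0; apply: (eq_of_sub (esym E2)); ring.
by move/eqP: E1; rewrite c0 mul0r !mul0r add0r mulr1 oppr_eq0 oner_eq0.
Qed.

Lemma cremona_tetrahedral_subgroup (a b : k) :
    (2%:R : k) != 0 -> -1 = a ^+ 2 + b ^+ 2 ->
  exists (gT : finGroupType) (f : {multiplicative gT -> cremona 1 k}),
    injective f /\ exists u v w : gT,
      [/\ u != v, (u * u = 1)%g, (w * u = v * w)%g & (w * v = u * v * w)%g].
Proof.
move=> two0 Eab; have [P [PM PZ P1 PI]] := cremona_matrix_action.
have Ebb : b * b = - 1 - a * a by rewrite Eab !expr2 addrAC subrr add0r.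
(* [U] and [V] anticommute and square to -1, as the quaternions [i] and [j]. [W] is
   [1 + U + V + V *m U], twice a Hurwitz unit, with determinant 4 and cube -8. *)
pose U := mx2 (0 : k) (-1) 1 0; pose V := mx2 (- b) a a b.
pose W := mx2 (1 + a - b) (-1 + a + b) (1 + a + b) (1 - a + b).
have dU : \det U = 1 by rewrite det_mx2; ring.
have dV : \det V = 1 by rewrite det_mx2; apply: (eq_of_sub (esym Ebb)); ring.
have dW : \det W = 2%:R * 2%:R.
  rewrite det_mx2; apply: (eq_of_sub (congr1 (fun x => (- 2%:R) * x) Ebb)); ring.
have nzU : \det U != 0 by rewrite dU oner_eq0.
have nzV : \det V != 0 by rewrite dV oner_eq0.
have nzW : \det W != 0 by rewrite dW mulf_neq0.
have nzM M N : \det M != 0 -> \det N != 0 -> \det (M *m N : 'M[k]_2) != 0.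
  by move=> *; rewrite det_mulmx mulf_neq0.
have scal c M : c != 0 -> M = c *: 1%:M -> P M = 1%g.
  by move=> c0 ->; rewrite PZ // det1 oner_eq0.
have n1 : (-1 : k) != 0 by rewrite oppr_eq0 oner_eq0.
have WW : W *m W = 2%:R *: W - (2%:R * 2%:R)%:M.
  rewrite !mx2E; congr mx2; try ring.
  + by apply: (eq_of_sub (congr1 (fun x => 2%:R * x) Ebb)); ring.
  + by apply: (eq_of_sub (congr1 (fun x => 2%:R * x) Ebb)); ring.
have WWW : W *m (W *m W) = - (2%:R * 2%:R * 2%:R) *: 1%:M.
  rewrite WW mulmxBr -scalemxAr WW mul_mx_scalar scalerBr scalerA addrAC subrr add0r.
  by rewrite !scale_scalar_mx -raddfN mulr1 mulrA.
have [|||||| gT [f [fI [u fu] [v fv] [w fw]]]] :=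
  @tetrahedral_subgroup _ (P U) (P V) (P W).
- rewrite PM //; apply: (scal (-1)) => //; rewrite !mx2E; congr mx2; ring.
- rewrite PM //; apply: (scal (-1)) => //; rewrite !mx2E; congr mx2; try ring.
  + by apply: (eq_of_sub Ebb); ring.
  + by apply: (eq_of_sub Ebb); ring.
- rewrite !PM //.
  have -> : V *m U = -1 *: (U *m V) by rewrite !mx2E; congr mx2; ring.
  by apply: PZ => //; apply: nzM.
- rewrite (PM W W) // (PM _ W) ?nzM // WWW; apply: scal (erefl _).
  by rewrite oppr_eq0 !mulf_neq0.
- rewrite !PM //; congr P; rewrite !mx2E; congr mx2;
  first [ring | by apply: (eq_of_sub Ebb); ring | by apply: (eq_of_sub (esym Ebb)); ring].
- rewrite !PM ?nzM //; congr P; rewrite !mx2E; congr mx2;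
  first [ring | by apply: (eq_of_sub Ebb); ring | by apply: (eq_of_sub (esym Ebb)); ring].
exists gT, f; split=> //; exists u, v, w; split.
- apply: contraNneq two0 => uv; have := congr1 f uv; rewrite fu fv => /PI[||c] //.
  rewrite mx2Z => /mx2_inj[_ E2 E3 _].
  by apply/eqP; apply: (eq_of_sub (etrans E3 (esym E2))); ring.
- by apply: fI; rewrite gmulfM fu PM // (scal (-1)) //;
    [rewrite multiplicative1 | rewrite !mx2E; congr mx2; ring].
- apply: fI; rewrite !gmulfM fu fv fw !PM //; congr P.
  by rewrite !mx2E; congr mx2; first [ring | by apply: (eq_of_sub Ebb); ring | by apply: (eq_of_sub (esym Ebb)); ring].
apply: fI; rewrite !gmulfM fu fv fw !PM ?nzM //; congr P.
by rewrite !mx2E; congr mx2; first [ring | by apply: (eq_of_sub Ebb); ring | by apply: (eq_of_sub (esym Ebb)); ring].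
Qed.

End CremonaGroupOfTheLine.

(** * Sums of two squares in odd characteristic *)

Section SumOfTwoSquares.
Local Open Scope ring_scope.
Variables (k : fieldType) (p : nat).
Hypothesis charp : p \in [pchar k].

Lemma natr_mod_pchar n : (n %% p)%N%:R = n%:R :> k.
Proof. by rewrite [in RHS](divn_eq n p) natrD natrM (pcharf0 charp) mulr0 add0r. Qed.

(* Pigeonhole: the [p./2 + 1] squares [i^2] and the [p./2 + 1] elements
   [-1 - i^2] of the prime field cannot all be distinct. *)
Lemma sum2sqr_pchar : (2 < p)%N -> exists a b : k, -1 = a ^+ 2 + b ^+ 2.
Proof.
move=> p_gt2; have pr_p := pcharf_prime charp.
have odd_p : odd p by case: (even_prime pr_p) p_gt2 => [->|].
pose I := iota 0 p./2.+1.
pose s1 : seq k := [seq i%:R ^+ 2 | i <- I].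
pose s2 : seq k := [seq -1 - i%:R ^+ 2 | i <- I].
have sqr_inj : {in I &, injective (fun i : nat => i%:R ^+ 2 : k)}.
  suff le_inj i j : (i <= j)%N -> i \in I -> j \in I ->
      (i%:R ^+ 2 : k) = j%:R ^+ 2 -> i = j.
    move=> i j Ii Ij E; case: (leqP i j) => [le_ij|/ltnW le_ji].
      exact: le_inj.
    by apply/esym/le_inj.
  rewrite !mem_iota !add0n /= => leij ltip ltjp /eqP.
  rewrite eq_sym -subr_eq0 subr_sqr mulf_eq0 -natrB // -natrD -!(dvdn_pcharf charp).
  have := odd_double_half p; rewrite odd_p => Ep.
  case/orP=> [|]; [have [//|lt0] := posnP (j - i)|have [//|lt0] := posnP (j + i)].
  - by move=> E _; apply/eqP; rewrite eqn_leq leij -subn_eq0 E eqxx.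
  - by move/(dvdn_leq lt0); lia.
  - by move=> E _; lia.
  by move/(dvdn_leq lt0); lia.
have [/hasP[_ /mapP[i _ ->] /mapP[j _ E]]|dis] := boolP (has (mem s1) s2).
  by exists i%:R, j%:R; rewrite -E addrC subrK.
have us : uniq (s1 ++ s2).
  rewrite cat_uniq dis !map_inj_in_uniq ?iota_uniq // => i j Ii Ij.
  by move/addrI/oppr_inj; apply: sqr_inj.
have sub : {subset s1 ++ s2 <= [seq n%:R | n <- iota 0 p]}.
  have mem n : (n%:R : k) \in [seq n%:R | n <- iota 0 p].
    by rewrite -natr_mod_pchar map_f // mem_iota ltn_mod prime_gt0.
  move=> x; rewrite mem_cat => /orP[] /mapP[i _ ->]; first by rewrite -natrX mem.
  have -> : -1 - i%:R ^+ 2 = (p.-1 * (1 + i ^ 2))%:R :> k.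
    have p1 : (p.-1%:R : k) = -1.
      apply/eqP; rewrite -subr_eq0 opprK -(natrD _ _ 1) addn1 prednK ?prime_gt0 //.
      by rewrite (pcharf0 charp).
    by rewrite natrM p1 natrD natrX; ring.
  exact: mem.
have := uniq_leq_size us sub; rewrite size_cat !size_map !size_iota.
have := odd_double_half p; rewrite odd_p; lia.
Qed.
End SumOfTwoSquares.

From mathcomp Require Import classical_sets.
Import Order.TTheory Num.Theory.

(** * From upper and lower bounds to the supremum *)

Section RepresentationDimensionOfCremona.
Variable k : fieldType.

Lemma rdim_le (gT : finGroupType) N :
  has_faithful_repr k [set: gT] N -> (rdim k [set: gT] <= N)%N.
Proof. by rewrite /rdim; case: ex_minnP => m _ min_m /asboolP/min_m. Qed.

Lemma rdim_faithful (gT : finGroupType) :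
  has_faithful_repr k [set: gT] (rdim k [set: gT]).
Proof. by rewrite /rdim; case: ex_minnP => m /asboolP. Qed.

Lemma supremum_max d (T : porderType d) (x0 x : T) (S : set T) :
  S x -> ubound S x -> supremum x0 S = x.
Proof.
move=> Sx ubx; rewrite /supremum ifF; last by apply/negP => /eqP S0; rewrite S0 in Sx.
apply: xget_unique; first by split=> // y; apply.
move=> y [uby lby]; apply: le_anti; rewrite uby // andbT.
exact: lby.
Qed.

Lemma cremona_c_eq N :
    (forall (gT : finGroupType) (f : {multiplicative gT -> cremona 1 k}),
       injective f -> has_faithful_repr k [set: gT] N) ->
    (exists (gT : finGroupType) (f : {multiplicative gT -> cremona 1 k}),
       injective f /\ forall n, has_faithful_repr k [set: gT] n -> (N <= n)%N) ->
  cremona_c 1 k = (N%:Z)%:E.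
Proof.
move=> upper [gT [f [fI lower]]]; apply: supremum_max.
  exists gT; split; first by exists f.
  congr (_%:Z)%:E; apply/eqP; rewrite eqn_leq lower ?rdim_le //.
    exact: upper fI.
  exact: rdim_faithful.
by move=> _ [hT [[g gI] ->]]; rewrite lee_fin lez_nat rdim_le //; apply: upper gI.
Qed.

End RepresentationDimensionOfCremona.

Theorem theorem1p1 (k : fieldType) :
  cremona_c 1 k =
    if 2%N \in [pchar k]%R then 2%:E
    else if `[< exists p : nat, (3 <= p)%N /\ p \in [pchar k]%R >] then 3%:E
    else if `[< [pchar k]%R =i pred0
                /\ exists a b : k, (-1 = a ^+ 2 + b ^+ 2)%R >] then 3%:E
    else 2%:E.
Proof.
have lower2 : exists (gT : finGroupType) (f : {multiplicative gT -> cremona 1 k}),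
    injective f /\ forall n, has_faithful_repr k [set: gT] n -> (2 <= n)%N.
  have [gT [f [fI [u [w uw]]]]] := cremona_noncommutative_subgroup k.
  by exists gT, f; split=> // n; apply: faithful_noncommutative uw.
have upper (gT : finGroupType) (f : {multiplicative gT -> cremona 1 k}) :
    injective f -> has_faithful_repr k [set: gT] 3.
  by move=> /proj_faithful_of_cremona[A projA]; apply: faithful_of_proj_sym2 projA.
case: ifPn => [ch2|nch2].
  apply: (cremona_c_eq (N := 2)) => // gT f /proj_faithful_of_cremona[A projA].
  exact: faithful_of_proj_char2 projA ch2.
have two_neq0 : (2%:R : k)%R != 0%R by move: nch2; rewrite inE.
have sum2sqr_case : (exists a b : k, (-1 = a ^+ 2 + b ^+ 2)%R) -> cremona_c 1 k = 3%:E.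
  move=> [a [b Eab]]; apply: (cremona_c_eq (N := 3)) => //.
  have [gT [f [fI [u [v [w [uv u2 wu wv]]]]]]] := cremona_tetrahedral_subgroup two_neq0 Eab.
  by exists gT, f; split=> // n; apply: faithful_tetrahedral uv u2 wu wv.
case: asboolP => [[p [p_ge3 charp]]|no_p].
  exact/sum2sqr_case/(sum2sqr_pchar charp).
have char0 : [pchar k]%R =i pred0.
  move=> p; rewrite [RHS]inE; apply/negP => charp; apply: no_p; exists p; split=> //.
  have := prime_gt1 (pcharf_prime charp); rewrite leq_eqVlt => /orP[/eqP p2|//].
  by rewrite p2 charp in nch2.
case: asboolP => [[_]|no_sum]; first exact: sum2sqr_case.
apply: (cremona_c_eq (N := 2)) => // gT f /proj_faithful_of_cremona[A projA].
by apply: faithful_of_proj_char0 projA => // sum; apply: no_sum.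
Qed.
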